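(* Let $f,g$ be M\''obius transformations with $\beta=\beta(f)\neq-4$, $\beta(g)=-4$, $\gamma=\gamma(f,g)$, and suppose that $\langle f,g\rangle$ is not discrete and free on the two generators $f$ and $g$ (i.e. it is not the case that $\langle f,g\rangle$ is both discrete and equal to the free product $\langle f\rangle*\langle g\rangle$). Then for any open set $U\subset\mathbb{C}$ with $\gamma\in U$ there is a good word $w$ for which the polynomial $q_w(z)=p_w(\beta,z)$ is not identically zero and has a root in $U$.
   Context: M\''obius transformations are identified with elements of $PSL(2,\mathbb{C})$. For $f,g$ represented by $A,B\in SL(2,\mathbb{C})$: $\beta(f)=\mathrm{tr}^2(A)-4$, $\gamma(f,g)=\mathrm{tr}(ABA^{-1}B^{-1})-2$. A good word on letters $a,b$ is a word $w(a,b)=b^{s_1}a^{r_1}b^{s_2}a^{r_2}\cdots a^{r_{m-1}}b^{s_m}$ with $s_1=\pm1$, $s_j=(-1)^{j+1}s_1$, and $r_j\in\mathbb{Z}$ (possibly $0$, so words may begin or end with a power of $a$). For every good word $w$ there is a polynomial $p_w\in\mathbb{Z}[x,z]$, uniquely determined by the property that $\gamma(f,w(f,g))=p_w(\beta(f),\gamma(f,g))$ for all $f,g\in PSL(2,\mathbb{C})$. *)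

(* Defs.v *)
From HB Require Import structures.
From mathcomp Require Import all_boot all_order all_algebra.
From mathcomp Require Import complex ring.
From mathcomp Require Import all_classical all_reals all_analysis.

Set Implicit Arguments.
Unset Strict Implicit.
Unset Printing Implicit Defensive.

Import Order.TTheory GRing.Theory Num.Theory.
Import numFieldNormedType.Exports.

Local Open Scope classical_set_scope.
Local Open Scope quotient_scope.
Local Open Scope ring_scope.

Section SL2.
Variable C : numFieldType.

Record SL2 := MkSL2 { SL2mx :> 'M[C]_2 ; SL2P : \det SL2mx == 1 }.
HB.instance Definition _ := [isSub for SL2mx].
HB.instance Definition _ := [Choice of SL2 by <:].

Fact SL2_unit (A : SL2) : SL2mx A \in unitmx.
Proof. by rewrite unitmxE (eqP (SL2P A)) unitr1. Qed.

Fact SL2_mul_subproof (A B : SL2) : \det (A *m B) == 1.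
Proof. by rewrite det_mulmx (eqP (SL2P A)) (eqP (SL2P B)) mulr1. Qed.

Fact SL2_one_subproof : \det (1%:M : 'M[C]_2) == 1.
Proof. by rewrite det1. Qed.

Fact SL2_inv_subproof (A : SL2) : \det (invmx A) == 1.
Proof. by rewrite det_inv (eqP (SL2P A)) invr1. Qed.

Fact SL2_opp_subproof (A : SL2) : \det (- (A : 'M[C]_2)) == 1.
Proof. by rewrite -scaleN1r detZ sqrrN expr1n mul1r (SL2P A). Qed.

Definition SL2_mul A B := MkSL2 (SL2_mul_subproof A B).
Definition SL2_one := MkSL2 SL2_one_subproof.
Definition SL2_inv A := MkSL2 (SL2_inv_subproof A).
Definition SL2_opp A := MkSL2 (SL2_opp_subproof A).

Fact SL2_mulA : associative SL2_mul.
Proof. by move=> A B D; apply: val_inj; rewrite /= mulmxA. Qed.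
Fact SL2_mul1 : left_id SL2_one SL2_mul.
Proof. by move=> A; apply: val_inj; rewrite /= mul1mx. Qed.
Fact SL2_mulr1 : right_id SL2_one SL2_mul.
Proof. by move=> A; apply: val_inj; rewrite /= mulmx1. Qed.
Fact SL2_mulV : left_inverse SL2_one SL2_inv SL2_mul.
Proof. by move=> A; apply: val_inj; rewrite /= mulVmx ?SL2_unit. Qed.
Fact SL2_mulrV : right_inverse SL2_one SL2_inv SL2_mul.
Proof. by move=> A; apply: val_inj; rewrite /= mulmxV ?SL2_unit. Qed.

HB.instance Definition _ :=
  isGroup.Build SL2 SL2_mulA SL2_mul1 SL2_mulr1 SL2_mulV SL2_mulrV.

HB.instance Definition _ := Topological.copy SL2 (initial_topology SL2mx).


Definition SL2_eqrel (A B : SL2) : bool := (A == B) || (A == SL2_opp B).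

Fact SL2_oppK : involutive SL2_opp.
Proof. by move=> A; apply: val_inj; rewrite /= opprK. Qed.

Lemma SL2_mulN A B : (SL2_opp A * B = SL2_opp (A * B))%g.
Proof. by apply: val_inj; rewrite /= mulNmx. Qed.

Lemma SL2_mulrN A B : (A * SL2_opp B = SL2_opp (A * B))%g.
Proof. by apply: val_inj; rewrite /= mulmxN. Qed.

Lemma SL2_invN A : ((SL2_opp A)^-1 = SL2_opp A^-1)%g.
Proof.
by apply: (mulIg (SL2_opp A)); rewrite mulVg SL2_mulN SL2_mulrN mulVg SL2_oppK.
Qed.

Fact SL2_eqrel_refl : reflexive SL2_eqrel.
Proof. by move=> A; rewrite /SL2_eqrel eqxx. Qed.
Fact SL2_eqrel_sym : symmetric SL2_eqrel.
Proof.
move=> A B; rewrite /SL2_eqrel [B == A]eq_sym; congr orb.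
by rewrite -(inj_eq (can_inj SL2_oppK)) SL2_oppK eq_sym.
Qed.
Fact SL2_eqrel_trans : transitive SL2_eqrel.
Proof.
move=> A B D /orP[] /eqP -> /orP[] /eqP ->;
  by rewrite /SL2_eqrel ?SL2_oppK eqxx ?orbT.
Qed.

Canonical SL2_equiv :=
  EquivRel SL2_eqrel SL2_eqrel_refl SL2_eqrel_sym SL2_eqrel_trans.

Definition PSL2 : Type := quotient_topology {eq_quot SL2_eqrel}.
HB.instance Definition _ := Quotient.on PSL2.
HB.instance Definition _ := Topological.on PSL2.

Implicit Types (A B : SL2) (f g : PSL2).

Lemma PSL2_eqP A B :
  reflect (A = B \/ A = SL2_opp B) (\pi_PSL2 A == \pi_PSL2 B).
Proof.
rewrite (_ : (_ == _) = SL2_eqrel A B).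
  by apply: (iffP orP) => -[/eqP|/eqP]; [left|right|left|right].
by apply/eqP/idP => [/eqmodP|?]; last exact/eqmodP.
Qed.

Lemma repr_PSL2 A :
  repr (\pi_PSL2 A) = A \/ repr (\pi_PSL2 A) = SL2_opp A.
Proof. by apply/PSL2_eqP; rewrite reprK. Qed.

Definition PSL2_mul f g := \pi_PSL2 (repr f * repr g)%g.
Definition PSL2_one := \pi_PSL2 (1 : SL2)%g.
Definition PSL2_inv f := \pi_PSL2 (repr f)^-1%g.

Lemma PSL2_mulE A B :
  PSL2_mul (\pi_PSL2 A) (\pi_PSL2 B) = \pi_PSL2 (A * B)%g.
Proof.
apply/eqP/PSL2_eqP.
case: (repr_PSL2 A) (repr_PSL2 B) => -> [] ->;
  rewrite ?(SL2_mulN, SL2_mulrN, SL2_oppK); by [left|right].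
Qed.

Lemma PSL2_invE A : PSL2_inv (\pi_PSL2 A) = \pi_PSL2 A^-1%g.
Proof.
apply/eqP/PSL2_eqP; case: (repr_PSL2 A) => ->; [by left|right].
by rewrite SL2_invN.
Qed.

Fact PSL2_mulA : associative PSL2_mul.
Proof.
elim/quotW => A; elim/quotW => B; elim/quotW => D.
by rewrite (PSL2_mulE B D) (PSL2_mulE A B) !PSL2_mulE mulgA.
Qed.
Fact PSL2_mul1 : left_id PSL2_one PSL2_mul.
Proof. by elim/quotW => A; rewrite PSL2_mulE mul1g. Qed.
Fact PSL2_mulr1 : right_id PSL2_one PSL2_mul.
Proof. by elim/quotW => A; rewrite PSL2_mulE mulg1. Qed.
Fact PSL2_mulV : left_inverse PSL2_one PSL2_inv PSL2_mul.
Proof. by elim/quotW => A; rewrite PSL2_invE PSL2_mulE mulVg. Qed.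
Fact PSL2_mulrV : right_inverse PSL2_one PSL2_inv PSL2_mul.
Proof. by elim/quotW => A; rewrite PSL2_invE PSL2_mulE mulgV. Qed.

HB.instance Definition _ :=
  isGroup.Build PSL2 PSL2_mulA PSL2_mul1 PSL2_mulr1 PSL2_mulV PSL2_mulrV.

Definition beta f : C := \tr (repr f) ^+ 2 - 4.

Definition gamma f g : C :=
  let A := repr f in let B := repr g in \tr (A * B * A^-1 * B^-1)%g - 2.

Lemma beta_pi A : beta (\pi_PSL2 A) = \tr A ^+ 2 - 4.
Proof.
by rewrite /beta; case: (repr_PSL2 A) => -> //=; rewrite raddfN sqrrN.
Qed.

Lemma gamma_pi A B :
  gamma (\pi_PSL2 A) (\pi_PSL2 B) = \tr (A * B * A^-1 * B^-1)%g - 2.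
Proof.
rewrite /gamma; case: (repr_PSL2 A) (repr_PSL2 B) => -> [] ->;
  by rewrite ?(SL2_invN, SL2_mulN, SL2_mulrN, SL2_oppK).
Qed.

End SL2.

Section FreeProduct.
Variable G : groupType.

Definition subgroup (H : set G) : Prop :=
  [/\ H 1%g, forall x y, H x -> H y -> H (x * y)%g &
      forall x, H x -> H x^-1%g].

Definition generated (A : set G) : set G := smallest subgroup A.

(* The letter (b, x) of a word stands for the element x of H (b = true) or of
   K (b = false). *)
Definition reduced_word (H K : set G) (s : seq (bool * G)) : Prop :=
  (forall t, t \in s -> (if t.1 then H else K) t.2 /\ t.2 <> 1%g) /\
  sorted (fun t u => t.1 != u.1) s.

(* L is the internal free product of its subgroups H and K: the canonical
   morphism from H * K to L is onto, and no normal form other than the empty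
   word lies in its kernel. *)
Definition is_free_product (L H K : set G) : Prop :=
  [/\ subgroup H, subgroup K, L = generated (H `|` K) &
      forall s, reduced_word H K s ->
        (\prod_(t <- s) t.2)%g = 1%g -> s = [::]].

End FreeProduct.

Definition discrete_subset (T : topologicalType) (A : set T) : Prop :=
  A `<=` isolated A.

Definition expgz (G : groupType) (x : G) (r : int) : G :=
  match r with Posz n => (x ^+ n)%g | Negz n => (x ^- n.+1)%g end.

(* GoodWord e [:: r_1; ...; r_(m-1)] is the word
   b^{s_1} a^{r_1} b^{s_2} ... a^{r_(m-1)} b^{s_m} with s_1 = (-1)^e. *)
Record good_word := GoodWord { gw_sign : bool; gw_exps : seq int }.

Fixpoint eval_alternating (G : groupType) (e : bool) (rs : seq int) (a b : G)
    : G :=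
  let bs := if e then b^-1%g else b in
  if rs is r :: rs' then (bs * expgz a r * eval_alternating (~~ e) rs' a b)%g
  else bs.

Definition gw_eval (G : groupType) (w : good_word) (a b : G) : G :=
  eval_alternating (gw_sign w) (gw_exps w) a b.

(* An element of Z[x, z] is represented as a polynomial in z with coefficients
   in Z[x]; eval_fst p x is the polynomial p(x, z) in z. *)
Definition eval_fst (C : numFieldType) (p : {poly {poly int}}) (x : C)
    : {poly C} :=
  map_poly (fun c : {poly int} => (map_poly intr c).[x]) p.

(* p = p_w *)
Definition is_trace_poly (C : numFieldType) (w : good_word)
    (p : {poly {poly int}}) : Prop :=
  forall f g : PSL2 C,
    gamma f (gw_eval w f g) = (eval_fst p (beta f)).[gamma f g].

Section TracePolyUnique.
Variable C : numClosedFieldType.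

Fact beta_gamma_surj (x y : C) :
  exists f g : PSL2 C, beta f = x /\ gamma f g = y.
Proof.
pose mk (a b c d : C) := (\matrix_(i < 2, j < 2)
  (if i == 0 then if j == 0 then a else b else if j == 0 then c else d)).
have det_mk a b c d : \det (mk a b c d) = a * d - b * c.
  rewrite (expand_det_row _ ord0) !big_ord_recl big_ord0 /cofactor !det_mx11 !mxE /=.
  by rewrite addr0 expr0 expr1; ring.
have mul_mk a b c d a' b' c' d' : mk a b c d *m mk a' b' c' d' =
    mk (a * a' + b * c') (a * b' + b * d') (c * a' + d * c') (c * b' + d * d').
  apply/matrixP => i j; rewrite !mxE !big_ord_recl big_ord0 !mxE /= addr0.
  by case: ifP; case: ifP.
have tr_mk a b c d : \tr (mk a b c d) = a + d.
  by rewrite /mxtrace !big_ord_recl big_ord0 !mxE /= addr0.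
have mk1 : mk 1 0 0 1 = 1%:M.
  by apply/matrixP => -[[|[|//]] ?] [[|[|//]] ?]; rewrite !mxE.
pose t := sqrtC (x + 4); pose s := sqrtC y.
have dA : \det (mk t (-1) 1 0) == 1 by rewrite det_mk; apply/eqP; ring.
have dA' : \det (mk 0 1 (-1) t) == 1 by rewrite det_mk; apply/eqP; ring.
have dB : \det (mk 1 s 0 1) == 1 by rewrite det_mk; apply/eqP; ring.
have dB' : \det (mk 1 (- s) 0 1) == 1 by rewrite det_mk; apply/eqP; ring.
pose A := MkSL2 dA; pose B := MkSL2 dB.
have AV : (A^-1)%g = MkSL2 dA'.
  apply: (mulIg A); rewrite mulVg; apply: val_inj; rewrite /= mul_mk -mk1.
  by congr mk; ring.
have BV : (B^-1)%g = MkSL2 dB'.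
  apply: (mulIg B); rewrite mulVg; apply: val_inj; rewrite /= mul_mk -mk1.
  by congr mk; ring.
exists (\pi_(PSL2 C) A), (\pi_(PSL2 C) B); split.
  by rewrite beta_pi /= tr_mk addr0 sqrtCK addrK.
rewrite gamma_pi AV BV /= !mul_mk tr_mk -[RHS]sqrtCK -/s.
by ring.
Qed.

Fact poly_ext (p q : {poly C}) : (forall x, p.[x] = q.[x]) -> p = q.
Proof.
move=> pq; apply/eqP; rewrite -subr_eq0; apply: contraT => d0.
have := max_poly_roots (rs := [seq n%:R | n <- iota 0 (size (p - q))]) d0.
rewrite size_map size_iota ltnn; apply.
  by apply/allP => x _; rewrite /root hornerD hornerN pq subrr.
by rewrite map_inj_uniq ?iota_uniq// => m n /eqP; rewrite eqr_nat => /eqP.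
Qed.

Lemma is_trace_poly_unique (w : good_word) (p q : {poly {poly int}}) :
  is_trace_poly C w p -> is_trace_poly C w q -> p = q.
Proof.
move=> hp hq; apply/polyP => i.
apply: (map_inj_poly (f := intr : int -> C)) => //; first exact: intr_inj.
apply: poly_ext => x; have pq : eval_fst p x = eval_fst q x.
  apply: poly_ext => y; have [f [g [<- <-]]] := beta_gamma_surj x y.
  by rewrite -hp -hq.
have := congr1 (fun u : {poly C} => u`_i) pq.
by rewrite /eval_fst !coef_map_id0 ?rmorph0 ?horner0.
Qed.

End TracePolyUnique.

(* Main.v *)
Require Import Defs.
From HB Require Import structures.
From mathcomp Require Import all_boot all_order all_algebra.
From mathcomp Require Import complex ring lra zify.
From mathcomp Require Import all_classical all_reals all_analysis.

Import Order.TTheory GRing.Theory Num.Theory.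
Import numFieldNormedType.Exports.

Local Open Scope classical_set_scope.
Local Open Scope ring_scope.

Set Implicit Arguments.
Unset Strict Implicit.
Unset Printing Implicit Defensive.

Import Normc.

(** Fix [beta = beta f], write [q_w z] for [p_w(beta, z)], and let S be the
    set of the roots of all the nonzero polynomials [q_w].  The theorem says
    that [gamma f g] lies in the closure of S.

    The good words form a semigroup under substitution of one for the letter b
    of the other, and this becomes composition of the polynomials
    ([word_poly_subst]); moreover [q_w] vanishes at 0, since f and g with
    [gamma f g = 0] have a common fixed point.  Hence S contains 0 and is
    backward invariant under every nonzero [q_v] ([word_root_pull]).  As
    nonconstant polynomials are open maps ([poly_open]), it is enough to find
    a word v such that [q_v (gamma f g)] is in the interior of the closure
    of S.

    Since g is an involution, every element of the group generated by f and g
    is a power of f or, up to powers of f on both sides, a good word all of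
    whose exponents are effective ([generated_normal_form]); for such a word w
    the polynomial [q_w] is not zero ([word_poly_neq0], a degree count), and
    [gamma f] does not change when its argument is multiplied by powers of f.  If the group is not the
    free product, a relation gives a w with [q_w (gamma f g) = 0].  If it is
    not discrete, elements close to 1 give w with [q_w (gamma f g)] as small
    as desired ([not_discrete_small_word]).  So the theorem follows if the
    closure of S is a neighbourhood of 0, a statement about beta alone
    ([word_root_dense_near0]).

    That statement comes from complex dynamics.  For a suitable word,
    0 is a superattracting fixed point of [q_w] ([trace_val_super]), so the
    semigroup contains polynomials [z^m u(z)] with [u(0) <> 0] and m as
    large as desired ([word_poly_high_order]).  Near 0 such a map multiplies
    relative distances by about m ([superattracting_covering]).  If a disc
    around a small point z missed S, so would discs around the forward images
    of z, of growing relative radius, until that radius is bounded below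
    ([avoids_grow]).  A polynomial of still higher order then spreads such a
    disc over all arguments, in particular over a piece of the negative real
    axis; but S is dense in ]-4, 0[, because [gamma f g = 2 cos x - 2] means
    that the commutator of f and g is a rotation, which has finite order for a
    dense set of angles x ([word_root_rotation],
    [finite_order_trace_dense]).

    The covering property rests on a minimum principle for polynomials without
    roots in a disc ([minimum_principle]), obtained by multiplying the values
    at the N-th roots of unity and letting N grow. *)

(** * Trace polynomials of good words *)
Section Recursion.
Variable T : comNzRingType.
Variables x z : T.

(** Let A and B be in SL2, [C = B A B^-1] (or [B^-1 A B]), [t = tr A] and
    [tr (A C^-1) = z + 2]; then [s = t^2] and [tau = tr (A C)].  The quadruple
    (a, c, o, p) encodes the matrix [a A + c C + o t + p t A C].  The factors t
    make this module stable under conjugation by A and B with coefficients in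
    Z[x, z]: all its elements are odd under the change of sign of A, so t
    itself only enters through its square. *)
Definition coords : Type := (T * T * T * T)%type.

Let s : T := x + 4.
Let tau : T := s - z - 2.

Definition conj_a (v : coords) : coords :=
  let: (a, c, o, p) := v in
  (a - tau * c + s * (1 - tau) * p, - c - s * p,
   o + c + tau * p, c + (s - 1) * p).

Definition conj_aV (v : coords) : coords :=
  let: (a, c, o, p) := v in
  (a + (s - tau) * c + s * p, (s - 1) * c + s * p,
   o - (z + 1) * c - (z + 2) * p, - c - p).

(** Conjugation by the letter b exchanges A and C; the remaining terms come
    from rewriting C A in terms of A C. *)
Definition conj_b (v : coords) : coords :=
  let: (a, c, o, p) := v in
  (c + s * p, a + s * p, o - (z + 2) * p, - p).

Definition conj_az (r : int) (v : coords) : coords :=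
  match r with Posz n => iter n conj_a v | Negz n => iter n.+1 conj_aV v end.

Fixpoint word_coords (rs : seq int) : coords :=
  if rs is r :: rs' then conj_b (conj_az r (word_coords rs'))
  else (0, 1, 0, 0).

(** With [y = w A w^-1], the commutator of A and w is [A y^-1 = A (t - y)], so
    that [gamma f w = t^2 - 2 - tr (A y)]. *)
Definition trace_val (rs : seq int) : T :=
  let: (a, c, o, p) := word_coords rs in
  s - 2 - (a * (s - 2) + c * tau + o * s + p * (s * tau - s)).

End Recursion.

Section Morphism.
Variables (T T' : comNzRingType) (phi : {rmorphism T -> T'}).

Definition map_coords (v : coords T) : coords T' :=
  let: (a, c, o, p) := v in (phi a, phi c, phi o, phi p).

Let morphE := (rmorphD phi, rmorphB phi, rmorphN phi, rmorphM phi, rmorph1 phi,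
               rmorph0 phi, rmorph_nat phi).

(** Thanks to this, one and the same recursion produces the polynomial, its
    values, and its specialisation at a given beta. *)
Lemma map_coords_word x z rs :
  map_coords (word_coords x z rs) = word_coords (phi x) (phi z) rs.
Proof.
elim: rs => [|r rs IH] /=; first by rewrite !morphE.
rewrite -IH {IH}.
have Ea v : map_coords (conj_a x z v) = conj_a (phi x) (phi z) (map_coords v).
  by case: v => [[[? ?] ?] ?]; rewrite /= !morphE.
have EV v : map_coords (conj_aV x z v) = conj_aV (phi x) (phi z) (map_coords v).
  by case: v => [[[? ?] ?] ?]; rewrite /= !morphE.
have Eb v : map_coords (conj_b x z v) = conj_b (phi x) (phi z) (map_coords v).
  by case: v => [[[? ?] ?] ?]; rewrite /= !morphE.
rewrite Eb; congr conj_b; move: (word_coords x z rs) => v.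
case: r => n; rewrite /conj_az; last first.
  by elim: n.+1 => //= k <-; rewrite EV.
by elim: n => //= k <-; rewrite Ea.
Qed.

Lemma rmorph_trace_val x z rs :
  phi (trace_val x z rs) = trace_val (phi x) (phi z) rs.
Proof.
rewrite /trace_val -map_coords_word.
by case: (word_coords x z rs) => [[[a c] o] p]; rewrite /= !morphE.
Qed.

End Morphism.

Definition trace_poly (rs : seq int) : {poly {poly int}} :=
  trace_val 'X%:P 'X rs.

Section MatrixSide.
Variable C : numFieldType.
Implicit Types (A B : SL2 C) (M N : 'M[C]_2).

Lemma ord2 (i : 'I_2) : i = 0 \/ i = 1.
Proof. by case: i => -[|[|//]] ?; [left|right]; apply: val_inj. Qed.

Lemma lift0E (i : 'I_1) : lift (0 : 'I_2) i = 1.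
Proof. by rewrite ord1; apply: val_inj. Qed.

Lemma lift1E (i : 'I_1) : lift (1 : 'I_2) i = 0.
Proof. by rewrite ord1; apply: val_inj. Qed.

Lemma mx2P M N : M 0 0 = N 0 0 -> M 0 1 = N 0 1 -> M 1 0 = N 1 0 ->
  M 1 1 = N 1 1 -> M = N.
Proof.
by move=> h00 h01 h10 h11; apply/matrixP => i j;
  case: (ord2 i) (ord2 j) => -> [] ->.
Qed.

Lemma mul_mx2 M N i j : (M *m N) i j = M i 0 * N 0 j + M i 1 * N 1 j.
Proof.
by rewrite mxE !big_ord_recl big_ord0 addr0 lift0E.
Qed.

Lemma tr_mx2 M : \tr M = M 0 0 + M 1 1.
Proof.
by rewrite /mxtrace !big_ord_recl big_ord0 addr0 lift0E.
Qed.

Lemma det_mx2 M : \det M = M 0 0 * M 1 1 - M 0 1 * M 1 0.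
Proof.
rewrite (expand_det_row _ ord0) !big_ord_recl big_ord0 /cofactor !det_mx11 !mxE.
by rewrite /= addr0 expr0 expr1 lift0E lift1E mul1r mulN1r mulrN.
Qed.

Lemma det_SL2 A : A 0 0 * A 1 1 - A 0 1 * A 1 0 = 1.
Proof. by rewrite -det_mx2; apply/eqP/SL2P. Qed.

Lemma SL2_CH A : (A *m A) = \tr A *: (A : 'M[C]_2) - 1%:M.
Proof.
have dA := det_SL2 A.
by apply: mx2P; rewrite !(mul_mx2, tr_mx2, mxE) /= -dA; ring.
Qed.

Lemma SL2_invE A : SL2mx (A^-1)%g = (\tr A)%:M - SL2mx A.
Proof.
have -> : SL2mx (A^-1)%g = invmx (SL2mx A) *m 1%:M by rewrite mulmx1.
apply: (canLR (mulKmx (SL2_unit A))); rewrite mulmxBr SL2_CH mul_mx_scalar.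
by rewrite opprB addrCA subrr addr0.
Qed.

Lemma tr_SL2V A : \tr (SL2mx (A^-1)%g) = \tr A.
Proof. by rewrite SL2_invE raddfB /= mxtrace_scalar; ring. Qed.

Lemma SL2_mulE A B : SL2mx (A * B)%g = SL2mx A *m SL2mx B.
Proof. by []. Qed.

Lemma tr_SL2C A B : \tr (SL2mx (A * B)%g) = \tr (SL2mx (B * A)%g).
Proof. exact: mxtrace_mulC. Qed.

Lemma tr_SL2J A B : \tr (SL2mx (B * A * B^-1)%g) = \tr A.
Proof. by rewrite tr_SL2C mulgA mulVg mul1g. Qed.

Lemma mx2_anticomm M N : N *m M = \tr N *: M + \tr M *: N - M *m N
  - (\tr M * \tr N - \tr (M *m N))%:M.
Proof.
by apply: mx2P; rewrite !(mul_mx2, tr_mx2, mxE) /=; ring.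
Qed.

(** From Cayley-Hamilton for A N, whose adjugate is adj N adj A. *)
Lemma mx2_sandwich A N : SL2mx A *m N *m SL2mx A =
  \tr (SL2mx A *m N) *: SL2mx A - (\tr N)%:M + N.
Proof.
have -> : SL2mx A *m N *m SL2mx A = \tr (SL2mx A *m N) *: SL2mx A -
    (A 0 0 * A 1 1 - A 0 1 * A 1 0) *: ((\tr N)%:M - N).
  by apply: mx2P; rewrite !(mul_mx2, tr_mx2, mxE) /=; ring.
by rewrite det_SL2 scale1r opprB addrCA addrC.
Qed.

Section Conjugation.
Variables (A X : SL2 C) (z : C).
Hypotheses (trX : \tr X = \tr A) (trAX : \tr (SL2mx (A * X^-1)%g) = z + 2).

Let t := \tr A.
Let x := t ^+ 2 - 4.

Definition coords_mx (v : coords C) (A X : SL2 C) : 'M[C]_2 :=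
  let: (a, c, o, p) := v in
  a *: SL2mx A + c *: SL2mx X + (o * \tr A)%:M + (p * \tr A) *: (SL2mx A *m SL2mx X).

Let trAX' : \tr (SL2mx A *m SL2mx X) = t ^+ 2 - z - 2.
Proof.
move: trAX; rewrite SL2_mulE SL2_invE mulmxBr mul_mx_scalar trX raddfB /= mxtraceZ.
by rewrite -/t => h; rewrite -(addrK 2 z) -h; ring.
Qed.

Let CH : SL2mx A *m SL2mx A = t *: SL2mx A - 1%:M := SL2_CH A.

Let XA : SL2mx X *m SL2mx A = t *: SL2mx A + t *: SL2mx X - SL2mx A *m SL2mx X
  - (z + 2)%:M.
Proof. by rewrite mx2_anticomm trX trAX' -/t; congr (_ - _%:M); ring. Qed.

Let AXA : SL2mx A *m SL2mx X *m SL2mx A =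
  (t ^+ 2 - z - 2) *: SL2mx A - t%:M + SL2mx X.
Proof. by rewrite mx2_sandwich trX trAX' -/t. Qed.

Let AAX : SL2mx A *m (SL2mx A *m SL2mx X) = t *: (SL2mx A *m SL2mx X) - SL2mx X.
Proof. by rewrite mulmxA CH mulmxBl mul1mx -scalemxAl. Qed.

Let AAXA : SL2mx A *m (SL2mx A *m SL2mx X) *m SL2mx A =
  t *: ((t ^+ 2 - z - 2) *: SL2mx A - t%:M + SL2mx X) - SL2mx X *m SL2mx A.
Proof. by rewrite AAX mulmxBl -scalemxAl AXA. Qed.

Lemma conj_a_mx v :
  SL2mx A *m coords_mx v A X *m SL2mx (A^-1)%g = coords_mx (conj_a x z v) A X.
Proof.
rewrite SL2_invE; case: v => [[[a c] o] p] /=; rewrite -/t.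
rewrite mulmxBr mul_mx_scalar.
rewrite !mulmxDr !mulmxDl -!scalemxAr -!scalemxAl mul_mx_scalar -!scalemxAl.
rewrite CH AAXA AAX AXA XA mulmxBl mul1mx -scalemxAl CH.
move: (SL2mx A *m SL2mx X) => D; apply/matrixP => i j; rewrite !mxE.
by case: (i == j); rewrite /x /= ?mulr1n ?mulr0n; ring.
Qed.

Lemma conj_aV_mx v :
  SL2mx (A^-1)%g *m coords_mx v A X *m SL2mx A = coords_mx (conj_aV x z v) A X.
Proof.
rewrite SL2_invE; case: v => [[[a c] o] p] /=; rewrite -/t.
rewrite mulmxBl mul_scalar_mx.
rewrite !mulmxDr mulmxBl !mulmxDl -!scalemxAr -!scalemxAl.
rewrite !mulmxDl mul_mx_scalar -!scalemxAl.
rewrite CH AAXA AXA XA !mulmxBl mul1mx -!scalemxAl CH mul_scalar_mx.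
move: (SL2mx A *m SL2mx X) => D; apply/matrixP => i j; rewrite !mxE.
by case: (i == j); rewrite /x /= ?mulr1n ?mulr0n; ring.
Qed.

Lemma conj_az_mx r v :
  SL2mx (expgz A r) *m coords_mx v A X *m SL2mx (expgz A r)^-1%g =
  coords_mx (conj_az x z r v) A X.
Proof.
have SL2_1 : SL2mx (1 : SL2 C)%g = 1%:M by [].
case: r => n; rewrite /expgz /conj_az.
  elim: n => [|n IH]; first by rewrite expg0 invg1 SL2_1 mul1mx mulmx1.
  by rewrite iterS -conj_a_mx -IH expgS invgM !SL2_mulE !mulmxA.
rewrite invgK; elim: n.+1 => {n} [|n IH].
  by rewrite expg0 invg1 SL2_1 mul1mx mulmx1.
by rewrite iterS -conj_aV_mx -IH expgSr invgM !SL2_mulE !mulmxA.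
Qed.

End Conjugation.

Lemma conj_b_mx A B z v :
  \tr (SL2mx (A * (B * A * B^-1)^-1)%g) = z + 2 ->
  SL2mx B *m coords_mx v A (B^-1 * A * B)%g *m SL2mx B^-1%g =
  coords_mx (conj_b (\tr A ^+ 2 - 4) z v) A (B * A * B^-1)%g.
Proof.
set X := (B * A * B^-1)%g; set Y := (B^-1 * A * B)%g => trAX.
have trX : \tr X = \tr A by rewrite tr_SL2J.
have BB : SL2mx B *m SL2mx B^-1%g = 1%:M by rewrite -SL2_mulE mulgV.
have BYB : SL2mx B *m SL2mx Y *m SL2mx B^-1%g = SL2mx A.
  by rewrite -!SL2_mulE /Y !mulgA mulgV mul1g mulgK.
have BAYB : SL2mx B *m (SL2mx A *m SL2mx Y) *m SL2mx B^-1%g =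
    SL2mx X *m SL2mx A.
  by rewrite -!SL2_mulE /X /Y !mulgA mulgK.
have trAX' : \tr (SL2mx A *m SL2mx X) = \tr A ^+ 2 - z - 2.
  move: trAX; rewrite SL2_mulE SL2_invE mulmxBr mul_mx_scalar trX raddfB /=.
  by rewrite mxtraceZ => h; rewrite -(addrK 2 z) -h; ring.
case: v => [[[a c] o] p]; rewrite /coords_mx /conj_b.
rewrite !mulmxDr !mulmxDl -!scalemxAr -!scalemxAl mul_mx_scalar -!scalemxAl.
rewrite BB BYB BAYB (_ : _ *m _ *m _ = SL2mx X) // mx2_anticomm trX trAX'.
move: (SL2mx A *m SL2mx X) => D; apply/matrixP => i j; rewrite !mxE.
by case: (i == j); rewrite /= ?mulr1n ?mulr0n; ring.
Qed.

Definition letter (G : groupType) (e : bool) (b : G) : G :=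
  if e then b^-1%g else b.

Lemma letterN (G : groupType) e (b : G) : letter (~~ e) b = (letter e b)^-1%g.
Proof. by case: e; rewrite /letter /= ?invgK. Qed.

(** The parameter gamma does not distinguish B from its inverse, which is why
    the sign of a good word does not affect its polynomial. *)
Lemma tr_commutator_letter A B e :
  \tr (SL2mx (A * (letter e B * A * (letter e B)^-1)^-1)%g) =
  \tr (SL2mx (A * B * A^-1 * B^-1)%g).
Proof.
case: e; rewrite /letter !invgM ?invgK !mulgA //.
by rewrite tr_SL2C -[RHS]tr_SL2V !invgM !invgK !mulgA.
Qed.

(** Peeling off the first syllable [b^e a^r] of the word: the inner word
    starts with the opposite sign, so its coordinates refer to the other
    conjugate of A, and conjugation by [b^e] exchanges the two. *)
Lemma word_coords_mx A B z e rs :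
  \tr (SL2mx (A * B * A^-1 * B^-1)%g) = z + 2 ->
  SL2mx (eval_alternating e rs A B * A * (eval_alternating e rs A B)^-1)%g =
  coords_mx (word_coords (\tr A ^+ 2 - 4) z rs) A
    (letter e B * A * (letter e B)^-1)%g.
Proof.
move=> hz; elim: rs e => [|r rs IH] e.
  by rewrite /word_coords /coords_mx !mul0r !scale0r scale1r raddf0 !addr0 add0r.
set W := eval_alternating (~~ e) rs A B; set b := letter e B.
have -> : eval_alternating e (r :: rs) A B = (b * expgz A r * W)%g by [].
have -> : (b * expgz A r * W * A * (b * expgz A r * W)^-1 =
   b * (expgz A r * (W * A * W^-1) * (expgz A r)^-1) * b^-1)%g.
  by rewrite !invgM !mulgA.
have IHe : SL2mx (W * A * W^-1)%g =
    coords_mx (word_coords (\tr A ^+ 2 - 4) z rs) A (b^-1 * A * b)%g.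
  by rewrite IH letterN invgK.
rewrite 4!SL2_mulE IHe (@conj_az_mx _ _ z).
- by rewrite (conj_b_mx (z := z)) // tr_commutator_letter.
- by rewrite -{2}[b]invgK tr_SL2J.
- by rewrite -{2}[b]invgK -letterN tr_commutator_letter.
Qed.

(** A constant of its own, so that rewriting does not have to look through the
    quotient structure of PSL2. *)
Definition mobius A : PSL2 C := (\pi_(PSL2 C) A)%qT.

Lemma mobius_surj (f : PSL2 C) : exists A, f = mobius A.
Proof. by exists (repr f); rewrite /mobius reprK. Qed.

Lemma mobiusM A B : mobius (A * B)%g = (mobius A * mobius B)%g.
Proof. exact/esym/PSL2_mulE. Qed.

Lemma mobiusV A : mobius A^-1%g = (mobius A)^-1%g.
Proof. exact/esym/PSL2_invE. Qed.

Lemma mobius1 : mobius 1%g = 1%g.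
Proof. by []. Qed.

Lemma mobiusX A r : mobius (expgz A r) = expgz (mobius A) r.
Proof.
have E n : mobius (A ^+ n)%g = (mobius A ^+ n)%g.
  by elim: n => [|n IH]; rewrite ?expg0 ?mobius1 // !expgS mobiusM IH.
by case: r => n; rewrite /expgz -?E // mobiusV.
Qed.

Lemma beta_mobius A : beta (mobius A) = \tr A ^+ 2 - 4.
Proof. exact: beta_pi. Qed.

Lemma gamma_mobius A B :
  gamma (mobius A) (mobius B) = \tr (SL2mx (A * B * A^-1 * B^-1)%g) - 2.
Proof. exact: gamma_pi. Qed.

Lemma gamma_commute A B : commute A B -> gamma (mobius A) (mobius B) = 0.
Proof.
move=> AB; rewrite gamma_mobius AB mulgK mulgV.
by rewrite (_ : SL2mx 1%g = 1%:M) // mxtrace1 subrr.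
Qed.

Lemma mobius_word A B e rs :
  mobius (eval_alternating e rs A B) =
  eval_alternating e rs (mobius A) (mobius B).
Proof.
by elim: rs e => [|r rs IH] [] /=; rewrite ?mobiusM ?mobiusX ?mobiusV ?IH.
Qed.

Lemma gamma_word (f g : PSL2 C) e rs :
  gamma f (eval_alternating e rs f g) = trace_val (beta f) (gamma f g) rs.
Proof.
have [A ->] := mobius_surj f; have [B ->] := mobius_surj g.
rewrite -mobius_word beta_mobius !gamma_mobius.
set z := \tr (SL2mx (A * B * A^-1 * B^-1)%g) - 2.
have hz : \tr (SL2mx (A * B * A^-1 * B^-1)%g) = z + 2 by rewrite /z subrK.
clearbody z; set W := eval_alternating e rs A B.
have -> : (A * W * A^-1 * W^-1 = A * (W * A * W^-1)^-1)%g.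
  by rewrite !invgM invgK !mulgA.
rewrite SL2_mulE SL2_invE mulmxBr mul_mx_scalar tr_SL2J.
rewrite (word_coords_mx _ _ hz) /trace_val -/z raddfB /= mxtraceZ.
have trX : \tr (letter e B * A * (letter e B)^-1)%g = \tr A.
  exact: tr_SL2J.
move: (tr_commutator_letter A B e); rewrite hz.
move: (letter e B * A * (letter e B)^-1)%g trX => X trX trAX.
have trAX' : \tr (SL2mx A *m SL2mx X) = \tr A ^+ 2 - z - 2.
  move: trAX; rewrite SL2_mulE SL2_invE mulmxBr mul_mx_scalar trX raddfB /=.
  by rewrite mxtraceZ => h; rewrite -(addrK 2 z) -h; ring.
case: (word_coords _ _ _) => [[[a c] o] p]; rewrite /coords_mx.
rewrite !mulmxDr -!scalemxAr mul_mx_scalar mulmxA SL2_CH mulmxBl mul1mx.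
rewrite -scalemxAl !raddfD /= !mxtraceZ !(raddfN (@mxtrace C 2)) /= ?mxtraceZ
  mxtrace1 trAX' trX.
by ring.
Qed.

Lemma eval_trace_poly (x y : C) rs :
  (eval_fst (trace_poly rs) x).[y] = trace_val x y rs.
Proof.
pose phi : {rmorphism {poly {poly int}} -> C} :=
  horner_eval y \o map_poly (horner_eval x \o map_poly intr).
rewrite -[LHS]/(phi (trace_poly rs)) rmorph_trace_val /phi /=.
by rewrite map_polyX map_polyC /= map_polyX /horner_eval hornerC !hornerX.
Qed.

Lemma is_trace_poly_trace_poly w :
  is_trace_poly C w (trace_poly (gw_exps w)).
Proof. by move=> f g; rewrite eval_trace_poly -(gamma_word _ _ (gw_sign w)). Qed.

End MatrixSide.

(** * Substitution of good words *)
Section Substitution.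
Variable G : groupType.
Implicit Types (a b : G) (e : bool) (rs vs : seq int).

Lemma expgzN a r : expgz a (- r) = (expgz a r)^-1%g.
Proof.
case: r => [[|n]|n]; first by rewrite oppr0 /expgz expg0 invg1.
  by rewrite -NegzE.
by rewrite NegzE opprK /expgz invgK.
Qed.

Lemma eval_alternating_cat e rs r vs a b :
  eval_alternating e (rs ++ r :: vs) a b =
  (eval_alternating e rs a b * expgz a r *
   eval_alternating (~~ e (+) odd (size rs)) vs a b)%g.
Proof.
elim: rs e => [|r' rs IH] e /=; first by rewrite addbF.
by rewrite IH !mulgA negbK addNb addbN negbK.
Qed.

Definition inv_exps rs : seq int := rev [seq - r | r <- rs].

Lemma size_inv_exps rs : size (inv_exps rs) = size rs.
Proof. by rewrite size_rev size_map. Qed.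

Lemma eval_alternatingV e rs a b :
  (eval_alternating e rs a b)^-1%g =
  eval_alternating (~~ (e (+) odd (size rs))) (inv_exps rs) a b.
Proof.
elim: rs e => [|r rs IH] e; first by rewrite addbF; case: e; rewrite /= ?invgK.
rewrite /inv_exps map_cons rev_cons -cats1 eval_alternating_cat size_inv_exps.
rewrite [eval_alternating e _ _ _]/= !invgM mulgA expgzN IH /=.
rewrite -/(inv_exps _); congr (_ * _ * _)%g.
  by rewrite addbN addNb negbK.
by case: e; case: odd; rewrite /= ?invgK.
Qed.

(** A letter b is replaced by the word [vs] of sign [false], a letter [b^-1] by
    its inverse.  Both blocks are alternating, and the sign with which a block
    ends is opposite to the one with which the next block starts, so that the
    result is again a good word. *)
Fixpoint subst_exps e rs vs : seq int :=
  let block := if e then inv_exps vs else vs in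
  if rs is r :: rs' then block ++ r :: subst_exps (~~ e) rs' vs else block.

Lemma eval_subst_exps e rs vs a b :
  eval_alternating (e && ~~ odd (size vs)) (subst_exps e rs vs) a b =
  eval_alternating e rs a (eval_alternating false vs a b).
Proof.
have block e' : eval_alternating (e' && ~~ odd (size vs))
      (if e' then inv_exps vs else vs) a b =
    letter e' (eval_alternating false vs a b).
  by case: e'; rewrite /letter //= eval_alternatingV.
elim: rs e => [|r rs IH] e; first by rewrite /= block.
rewrite [subst_exps _ _ _]/= eval_alternating_cat block.
rewrite [RHS]/= -/(letter e _) -IH; congr (_ * eval_alternating _ _ _ _)%g.
by case: e; rewrite /= ?size_inv_exps; case: odd.
Qed.

Lemma commute_expgz a r : commute a (expgz a r).
Proof. by case: r => n; rewrite /expgz; [|apply: commuteV]; apply: commuteX. Qed.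

Lemma commute_eval_alternating1 e rs a :
  commute a (eval_alternating e rs a 1%g).
Proof.
elim: rs e => [|r rs IH] e /=; rewrite invg1 if_same; first exact: commute1.
by rewrite mul1g; apply: commuteM (commute_expgz a r) (IH _).
Qed.

End Substitution.

(** * Word polynomials and their roots *)
Section WordPolynomials.
Variable C : numClosedFieldType.
Variable beta0 : C.
Implicit Types (rs vs : seq int).

Definition word_poly rs : {poly C} := eval_fst (trace_poly rs) beta0.

Lemma word_polyE (f g : PSL2 C) e rs : beta f = beta0 ->
  (word_poly rs).[gamma f g] = gamma f (eval_alternating e rs f g).
Proof. by rewrite /word_poly => <-; rewrite eval_trace_poly gamma_word. Qed.

(** The pair (f, 1) realises [gamma = 0], and then the word is a power
    of f. *)
Lemma word_poly0 rs : (word_poly rs).[0] = 0.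
Proof.
have [f [_ [fE _]]] := beta_gamma_surj beta0 0; have [A fA] := mobius_surj f.
have g1 : gamma f (mobius 1%g) = 0.
  by rewrite fA; apply: gamma_commute; apply: commute1.
rewrite -[X in _.[X]]g1 (word_polyE _ false _ fE) fA -mobius_word.
exact/gamma_commute/commute_eval_alternating1.
Qed.

Lemma word_poly_subst rs vs :
  word_poly (subst_exps false rs vs) = word_poly rs \Po word_poly vs.
Proof.
apply: poly_ext => z; have [f [g [fE <-]]] := beta_gamma_surj beta0 z.
rewrite horner_comp (word_polyE _ false vs fE) (word_polyE _ false rs fE).
rewrite (word_polyE _ (false && ~~ odd (size vs)) (subst_exps _ _ _) fE).
by rewrite eval_subst_exps.
Qed.

Definition word_root (z : C) : Prop :=
  exists2 rs, word_poly rs != 0 & root (word_poly rs) z.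

Lemma word_poly_size rs : word_poly rs != 0 -> (1 < size (word_poly rs))%N.
Proof.
move=> n0; rewrite ltnNge; apply: contra n0 => /size1_polyC E.
by move: (word_poly0 rs); rewrite E hornerC => ->.
Qed.

Lemma word_poly_subst_neq0 rs vs : word_poly rs != 0 -> word_poly vs != 0 ->
  word_poly (subst_exps false rs vs) != 0.
Proof.
by move=> rs0 vs0; rewrite word_poly_subst comp_poly_eq0 // word_poly_size.
Qed.

(** Substituting [vs] in a word whose polynomial vanishes at the value of
    [word_poly vs] at z. *)
Lemma word_root_pull vs z : word_poly vs != 0 ->
  word_root (word_poly vs).[z] -> word_root z.
Proof.
move=> vs0 [rs rs0 rt]; exists (subst_exps false rs vs).
  exact: word_poly_subst_neq0.
by rewrite /root word_poly_subst horner_comp.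
Qed.

End WordPolynomials.

(** * Nonvanishing of word polynomials *)
Section NonVanishing.
Variable C : numClosedFieldType.
Implicit Types (A B : SL2 C) (rs : seq int).

Definition mx2 (a b c d : C) : 'M[C]_2 := \matrix_(i < 2, j < 2)
  (if i == 0 then if j == 0 then a else b else if j == 0 then c else d).

Lemma mx2E a b c d : (mx2 a b c d 0 0 = a) * (mx2 a b c d 0 1 = b) *
  (mx2 a b c d 1 0 = c) * (mx2 a b c d 1 1 = d).
Proof. by rewrite !mxE. Qed.

(** The coefficients are Chebyshev polynomials in t; what matters is that they
    are the same for all matrices of trace t. *)
Lemma expgz_affine (t : C) r : exists x y : C,
  forall B, \tr B = t -> SL2mx (expgz B r) = x *: SL2mx B + y%:M.
Proof.
have pos n : exists x y : C,
    forall B, \tr B = t -> SL2mx (B ^+ n)%g = x *: SL2mx B + y%:M.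
  elim: n => [|n [x [y IH]]]; first by exists 0, 1 => B _; rewrite scale0r add0r.
  exists (x * t + y), (- x) => B tB; rewrite expgS SL2_mulE IH // mulmxDr.
  rewrite -scalemxAr SL2_CH mul_mx_scalar tB scalerBr scalerA -scaleN1r.
  apply/matrixP => i j; rewrite !mxE; ring.
case: r => n; first exact: pos.
have [x [y E]] := pos n.+1; exists (- x), (x * t + y) => B tB.
rewrite /expgz -expVgn E ?tr_SL2V // SL2_invE tB.
by apply/matrixP => i j; rewrite !mxE; case: (i == j); rewrite /= ?mulr1n ?mulr0n; ring.
Qed.

Lemma mobius_eq1 A : mobius A = 1%g <-> SL2mx A = 1%:M \/ SL2mx A = - 1%:M.
Proof.
split=> [/eqP/PSL2_eqP[->|->]|AE]; [by left|by right|].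
by apply/eqP/PSL2_eqP; case: AE => AE; [left|right]; apply: val_inj.
Qed.

Variable A : SL2 C.
Let t := \tr A.

Lemma companion_subproof : \det (mx2 t (-1) 1 0) == 1.
Proof. by rewrite det_mx2 !mx2E mulr0 mulr1 sub0r opprK. Qed.

(** The polynomial of a word only depends on beta, so A may be replaced by the
    companion matrix of its characteristic polynomial, whose powers have a
    visible lower left entry. *)
Definition companion := MkSL2 companion_subproof.

Lemma tr_companion : \tr companion = t.
Proof. by rewrite tr_mx2 /= !mx2E addr0. Qed.

Lemma flip_subproof s : s != 0 -> \det (mx2 0 s (- s^-1) 0) == 1.
Proof. by move=> s0; rewrite det_mx2 !mx2E mulr0 sub0r mulrN opprK divff. Qed.

(** A half-turn depending on s; as s grows, s^-1 times this matrix approaches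
    a nilpotent matrix of rank one. *)
Definition flip s (s0 : s != 0) := MkSL2 (flip_subproof s0).

(** The expression of [gamma] in the entries of the second matrix.  It is a
    quadratic form, hence insensitive to the scaling of that matrix up to a
    square. *)
Definition gamma_form (a b c d : C) : C :=
  (t ^+ 2 - 4) * (a * d - b * c) + (a + d) ^+ 2 + (t * a - c + b) ^+ 2
  - t * (a + d) * (t * a - c + b).

Lemma gamma_companion B : gamma (mobius companion) (mobius B) =
  gamma_form (B 0 0) (B 0 1) (B 1 0) (B 1 1).
Proof.
rewrite gamma_mobius !SL2_mulE !SL2_invE.
have -> : \tr (SL2mx companion *m SL2mx B *m ((\tr companion)%:M - SL2mx companion)
    *m ((\tr B)%:M - SL2mx B)) = gamma_form (B 0 0) (B 0 1) (B 1 0) (B 1 1)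
    + 2 * (B 0 0 * B 1 1 - B 0 1 * B 1 0).
  rewrite tr_companion !(mul_mx2, tr_mx2, mxE) /= /gamma_form; ring.
by rewrite det_SL2; ring.
Qed.

(** If the coefficient x were zero, the power of A would be a scalar matrix of
    determinant 1. *)
Lemma mobius_expgz_neq1 r : expgz (mobius A) r != 1%g ->
  exists x y : C, x != 0 /\ SL2mx (expgz companion r) = x *: SL2mx companion + y%:M.
Proof.
move=> r1; have [x [y E]] := expgz_affine t r; exists x, y; split; last first.
  exact/E/tr_companion.
apply: contra r1 => /eqP x0; rewrite -mobiusX; apply/eqP/mobius_eq1.
have AE : SL2mx (expgz A r) = y%:M by rewrite E // x0 scale0r add0r.
have := det_SL2 (expgz A r); rewrite AE !mxE /= !mulr1n mulr0n mul0r subr0.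
move/eqP; rewrite -expr2 sqrf_eq1 => /orP[] /eqP ->; [by left|right].
by rewrite raddfN.
Qed.

Lemma size_polyD_le (n : nat) (p q : {poly C}) :
  (size p <= n)%N -> (size q <= n)%N -> (size (p + q)%R <= n)%N.
Proof. by move=> sp sq; rewrite (leq_trans (size_polyD _ _)) // geq_max sp. Qed.

Lemma size_polyZ_le (n : nat) k (p : {poly C}) :
  (size p <= n)%N -> (size (k *: p)%R <= n)%N.
Proof. exact: leq_trans (size_scale_leq k p). Qed.

Lemma size_polyXM_le (n : nat) (p : {poly C}) :
  (size p <= n)%N -> (size ('X * p)%R <= n.+1)%N.
Proof. by move=> sp; rewrite (leq_trans (size_polyMleq _ _)) // size_polyX. Qed.

(** Ping-pong in polynomial form.  Up to a scalar factor the entries of the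
    word are polynomials in [s^2], and each syllable raises the degree of the
    upper right entry by one, with leading coefficient multiplied by the lower
    left entry x of a power of the companion matrix, while the other entries
    have smaller degree. *)
Lemma word_companion rs :
  (forall r, r \in rs -> expgz (mobius A) r != 1%g) ->
  exists a b c d : {poly C},
    [/\ (size a <= (size rs).+1)%N, size b = (size rs).+2,
        (size c <= (size rs).+1)%N & (size d <= (size rs).+1)%N] /\
    forall s (s0 : s != 0) e, exists2 k, k != 0 &
      SL2mx (eval_alternating e rs companion (flip s0)) =
      k *: mx2 a.[s ^+ 2] b.[s ^+ 2] c.[s ^+ 2] d.[s ^+ 2].
Proof.
have flipE s (s0 : s != 0) e : exists2 k, k != 0 &
    SL2mx (letter e (flip s0)) = k *: mx2 0 (s ^+ 2) (-1) 0.
  exists (if e then - s^-1 else s^-1).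
    by case: e; rewrite ?oppr_eq0 invr_eq0.
  case: e; rewrite /letter ?SL2_invE; apply: mx2P;
    rewrite !(tr_mx2, mxE) /= ?mulr1n ?mulr0n; by field.
elim: rs => [|r rs IH] rs1.
  exists 0, 'X, (-1), 0; split; first by rewrite size_poly0 size_polyX size_polyN size_poly1.
  move=> s s0 e; have [k k0 E] := flipE s s0 e; exists k => //.
  by rewrite !horner0 hornerX hornerN hornerC.
have [|a [b [c [d [[sa sb sc sd] E]]]]] := IH.
  by move=> r' r'rs; apply: rs1; rewrite inE r'rs orbT.
have [|x [y [x0 Er]]] := @mobius_expgz_neq1 r; first by apply: rs1; rewrite inE eqxx.
exists ('X * (x *: a + y *: c)), ('X * (x *: b + y *: d)),
  (- ((x * t + y) *: a - x *: c)), (- ((x * t + y) *: b - x *: d)); split.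
  split.
  - by apply/size_polyXM_le/size_polyD_le; apply: size_polyZ_le.
  - have sxb : size (x *: b + y *: d) = (size rs).+2.
      have lt : (size (y *: d) < size (x *: b)%R)%N.
        by rewrite [X in (_ < X)%N]size_scale // sb ltnS (leq_trans (size_scale_leq _ _)).
      by rewrite size_polyDl // size_scale.
    by rewrite mulrC size_mulX ?sxb // -size_poly_eq0 sxb.
  - rewrite size_polyN -scaleNr; apply/leqW/size_polyD_le; exact: size_polyZ_le.
  - rewrite size_polyN -scaleNr; apply/size_polyD_le; apply: size_polyZ_le.
      by rewrite sb.
    exact: leqW.
move=> s s0 e; have [k k0 El] := flipE s s0 e.
have [k' k'0 EW] := E s s0 (~~ e); exists (k * k'); first by rewrite mulf_neq0.
rewrite [eval_alternating _ _ _ _]/= -/(letter e _) !SL2_mulE El Er EW.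
apply: mx2P; rewrite !(mul_mx2, mxE) /= !(hornerD, hornerN, hornerM, hornerX, hornerZ) ?mulr1n ?mulr0n; ring.
Qed.

(** The square of the upper right entry of [word_companion] dominates
    [gamma_form], so the values of gamma on the family cannot all vanish. *)
Lemma word_poly_neq0 rs :
  (forall r, r \in rs -> expgz (mobius A) r != 1%g) ->
  word_poly (t ^+ 2 - 4) rs != 0.
Proof.
move=> rs1; apply/negP => /eqP q0.
have [a [b [c [d [[sa sb sc sd] E]]]]] := word_companion rs1.
pose e1 : {poly C} := (2 * t) *: a + (-2) *: c + (- t) *: (a + d) + (4 - t ^+ 2) *: c.
pose e2 : {poly C} := (t ^+ 2 - 4) *: (a * d) + (a + d) ^+ 2 + (t *: a - c) ^+ 2
   - t *: ((a + d) * (t *: a - c)).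
(* gamma_form at the entries, as a polynomial in b; it vanishes at every
   nonzero square, hence identically. *)
have Qz : b ^+ 2 + b * e1 + e2 = 0.
  have nz x : x != 0 -> (b ^+ 2 + b * e1 + e2).[x] = 0.
    move=> x0; pose s := sqrtC x.
    have s0 : s != 0 by rewrite sqrtC_eq0.
    have [k k0 EW] := E s s0 false.
    have := @word_polyE _ (t ^+ 2 - 4) (mobius companion) (mobius (flip s0)) false rs.
    rewrite beta_mobius tr_companion q0 horner0 -mobius_word gamma_companion EW.
    rewrite !mxE /= sqrtCK => /(_ erefl) /esym h.
    apply: (mulfI (expf_neq0 2 k0)); rewrite mulr0 -h /gamma_form /e1 /e2 !(hornerD, hornerN, hornerM, hornerZ, horner_exp).
    ring.
  apply: (mulfI (negbT (polyX_eq0 C))); rewrite mulr0; apply: poly_ext => x.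
  rewrite hornerM hornerX horner0; have [->|/nz ->] := eqVneq x 0.
    by rewrite mul0r.
  by rewrite mulr0.
set n := size rs in sa sb sc sd.
have sad : (size (a + d)%R <= n.+1)%N by apply: size_polyD_le.
have sl : (size (t *: a - c)%R <= n.+1)%N.
  by apply: size_polyD_le; rewrite ?size_polyN //; apply: size_polyZ_le.
have s1 : (size e1 <= n.+1)%N.
  by rewrite /e1; do !apply: size_polyD_le; apply: size_polyZ_le.
have sM (p q : {poly C}) : (size p <= n.+1 -> size q <= n.+1 -> size (p * q)%R <= n.*2.+1)%N.
  by move: (size_polyMleq p q); lia.
have s2 : (size e2 <= n.*2.+1)%N.
  rewrite /e2 !expr2; do !apply: size_polyD_le; rewrite ?size_polyN.
  - exact/size_polyZ_le/sM.
  - exact: sM.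
  - exact: sM.
  - exact/size_polyZ_le/sM.
have b0 : b != 0 by rewrite -size_poly_eq0 sb.
have : (size (b ^+ 2)%R <= n.*2.+2)%N.
  have -> : b ^+ 2 = - (b * e1 + e2) by apply/eqP; rewrite -addr_eq0 addrA Qz.
  rewrite size_polyN; apply: size_polyD_le; last exact: leqW.
  by move: (size_polyMleq b e1); rewrite sb; lia.
by rewrite expr2 size_mul // sb; lia.
Qed.

End NonVanishing.

(** * A minimum principle for complex polynomials *)
Lemma prod_const_seq (T : pzSemiRingType) (I : Type) (s : seq I) (x : T) :
  \prod_(i <- s) x = x ^+ size s.
Proof. by rewrite big_const_seq count_predT iter_mulr_1. Qed.

Section Modulus.
Variable R : realType.
Implicit Types (x y z : R[i]) (p G : {poly R[i]}).

Lemma normcD x y : normc (x + y) <= normc x + normc y.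
Proof. exact: le_normcD. Qed.

Lemma normc_opp x : normc (- x) = normc x.
Proof. exact: normcN. Qed.

Lemma normcB x y : normc (x - y) = normc (y - x).
Proof. by rewrite -normc_opp opprB. Qed.

Lemma normc_geB x y : normc x - normc y <= normc (x - y).
Proof. by rewrite lerBlDr (le_trans _ (normcD _ _)) // subrK. Qed.

Lemma normc_ge0 x : 0 <= normc x.
Proof. by case: x => a b; exact: sqrtr_ge0. Qed.

Lemma normc_eq0 x : (normc x == 0) = (x == 0).
Proof. by apply/eqP/eqP => [/eq0_normc//|->]; rewrite normc0. Qed.

Lemma normc_gt0 x : (0 < normc x) = (x != 0).
Proof. by rewrite lt0r normc_eq0 normc_ge0 andbT. Qed.

Lemma normcX x n : normc (x ^+ n) = normc x ^+ n.
Proof. by elim: n => [|n IH]; rewrite ?expr0 ?normc1 // !exprS normcM IH. Qed.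

Lemma normc_prod (I : Type) (s : seq I) (F : I -> R[i]) :
  normc (\prod_(i <- s) F i) = \prod_(i <- s) normc (F i).
Proof. exact: (big_morph _ (@normcM R) (normc1 R)). Qed.

Lemma normc_real (a : R) : normc (a%:C)%C = `|a|.
Proof. by rewrite /= expr0n /= addr0 sqrtr_sqr. Qed.

Lemma expr_unbounded (a b : R) : 1 < a -> exists n, b < a ^+ n.
Proof.
move=> a1; have bern n : 1 + n%:R * (a - 1) <= a ^+ n.
  elim: n => [|n IH]; first by rewrite mul0r addr0 expr0.
  rewrite exprS -natr1; have an : 1 <= a ^+ n by rewrite exprn_ege1 // ltW.
  have : (a - 1) * 1 <= (a - 1) * a ^+ n by rewrite ler_wpM2l // subr_ge0 ltW.
  by lra.
have a0 : 0 < a - 1 by rewrite subr_gt0.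
exists (Num.bound (b / (a - 1))); apply: lt_le_trans (bern _).
rewrite ltr_wpDl // -ltr_pdivrMr //; exact: unstable.ltr_bound.
Qed.

Section MinimumPrinciple.
Variables (z : R[i]) (r : R).
Hypothesis r0 : 0 < r.

Lemma unity_prod n : (0 < n)%N -> exists s : seq R[i],
  [/\ size s = n, forall w, w \in s -> normc w = 1 &
      forall y, \prod_(w <- s) (y - w) = y ^+ n - 1].
Proof.
move=> n0; have [s E] := closed_field_poly_normal ('X^n - 1%:P : {poly R[i]}).
have lc : lead_coef ('X^n - 1%:P : {poly R[i]}) = 1.
  exact: lead_coefXnsubC.
rewrite lc scale1r in E; exists s; split.
- have := size_XnsubC (1 : R[i]) n0; rewrite E size_prod_XsubC => -[] //.
- move=> w ws; have : root ('X^n - 1%:P) w by rewrite E root_prod_XsubC.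
  rewrite /root !hornerE subr_eq0 => /eqP /(congr1 (@normc R)).
  rewrite normcX normc1 => /eqP; rewrite pexpr_eq1 // ?normc_ge0 //.
  by move/eqP.
- move=> y; have := congr1 (fun p => p.[y]) E; rewrite !hornerE => ->.
  by rewrite horner_prod; apply: eq_bigr => w _; rewrite !hornerE.
Qed.

(** Let a range over the d roots of G.  The product of the values of G at the
    N points [z + r w], with w an N-th root of unity, is computed root by root:
    the factor of a is [(z - a)^N - (- r)^N], of modulus at most
    [2 |z - a|^N] since no root is within r of z.  Hence
    [M^N <= 2^d |G(z)|^N] for all N, which forces [M <= |G(z)|]. *)
Lemma minimum_principle G M :
  (forall y, normc (y - z) = r -> M <= normc G.[y]) ->
  (forall y, normc (y - z) < r -> ~~ root G y) -> M <= normc G.[z].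
Proof.
move=> GM Gz; rewrite leNgt; apply/negP => lt.
have Gz0 : 0 < normc G.[z].
  by rewrite normc_gt0; apply: Gz; rewrite subrr normc0.
have M0 : 0 < M by apply: lt_trans lt.
have [s E] := closed_field_poly_normal G.
have sr a : a \in s -> r <= normc (z - a).
  move=> as_; rewrite normcB leNgt; apply/negP => /Gz/negP; apply.
  have := Gz z; rewrite subrr normc0 => /(_ r0).
  rewrite E /root !hornerZ !mulf_eq0 => /norP[_ _].
  by rewrite -/(root _ _) root_prod_XsubC as_ orbT.
have GE y : G.[y] = lead_coef G * \prod_(a <- s) (y - a).
  rewrite {1}E hornerZ horner_prod; congr (_ * _).
  by apply: eq_bigr => a _; rewrite !hornerE.
have [|n] := @expr_unbounded (M / normc G.[z]) (2 ^+ size s).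
  by rewrite ltr_pdivlMr // mul1r.
rewrite expr_div_n ltr_pdivlMr ?exprn_gt0 //.
have [->|n0] := posnP n.
  by rewrite !expr0 mulr1 ltNge exprn_ege1 // ler1n.
apply/negP; rewrite -leNgt.
have [u [su u1 uE]] := unity_prod n0.
pose rc : R[i] := (r%:C)%C.
have rc0 : rc != 0 by rewrite -normc_eq0 normc_real gt_eqF // gtr0_norm.
have factor b : r <= normc b -> normc (\prod_(w <- u) (b + rc * w)) <= 2 * normc b ^+ n.
  move=> rb; have -> : \prod_(w <- u) (b + rc * w) = (- rc) ^+ n * ((- b / rc) ^+ n - 1).
    rewrite -uE -su -prod_const_seq -big_split /=; apply: eq_bigr => w _.
    by field.
  rewrite normcM normcX normc_opp normc_real gtr0_norm //.
  apply: (@le_trans _ _ (r ^+ n * (normc (b / rc) ^+ n + 1))).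
    apply: ler_wpM2l; first by rewrite exprn_ge0 // ltW.
    apply: le_trans (normcD _ _) _.
    by rewrite normc_opp normc1 normcX mulNr normc_opp.
  rewrite normcM normcV normc_real gtr0_norm // expr_div_n mulrDr mulr1 mulrCA.
  rewrite divff ?mulr1 ?expf_neq0 ?gt_eqF // mulr_natl mulr2n lerD2l.
  by rewrite lerXn2r // ?nnegrE ?normc_ge0 // ltW.
apply: (@le_trans _ _ (\prod_(w <- u) normc G.[z + rc * w])).
  rewrite -su -prod_const_seq; rewrite big_seq [X in _ <= X]big_seq.
  apply: ler_prod => w wu; rewrite (ltW M0) GM // addrAC subrr add0r.
  by rewrite normcM (u1 w wu) mulr1 normc_real gtr0_norm.
rewrite -normc_prod.
have -> : \prod_(w <- u) G.[z + rc * w] =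
    lead_coef G ^+ n * \prod_(a <- s) \prod_(w <- u) (z - a + rc * w).
  rewrite exchange_big /= -su -prod_const_seq -big_split /=.
  by apply: eq_bigr => w _; rewrite GE; congr (_ * _); apply: eq_bigr => a _; ring.
rewrite normcM normcX GE normcM exprMn mulrCA ler_wpM2l ?exprn_ge0 ?normc_ge0 //.
rewrite !normc_prod -prodrXl -prod_const_seq -big_split /=.
rewrite big_seq [X in _ <= X]big_seq; apply: ler_prod => a /sr ra.
by rewrite normc_ge0 factor.
Qed.

Lemma root_in_disc G M : normc G.[z] < M ->
  (forall y, normc (y - z) = r -> M <= normc G.[y]) ->
  exists2 y, normc (y - z) < r & root G y.
Proof.
move=> lt GM; apply: contrapT => no; move: lt; rewrite ltNge => /negP; apply.
apply: minimum_principle GM _ => y yr; apply/negP => Gy; apply: no.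
by exists y.
Qed.

End MinimumPrinciple.

Lemma poly_lipschitz p : exists2 L : R, 0 < L & forall y z,
  normc y <= 1 -> normc z <= 1 -> normc (p.[y] - p.[z]) <= L * normc (y - z).
Proof.
suff [L [M [L0 H]]] : exists L M : R, 0 < L /\ forall y z,
    normc y <= 1 -> normc z <= 1 ->
    normc p.[y] <= M /\ normc (p.[y] - p.[z]) <= L * normc (y - z).
  by exists L => // y z y1 z1; have [] := H y z y1 z1.
elim/poly_ind: p => [|p c [L [M [L0 IH]]]].
  exists 1, 0; split=> // y z _ _; rewrite !horner0 subrr normc0 mul1r.
  by split; rewrite // normc_ge0.
exists (L + `|M|), (M + normc c); split; first by rewrite ltr_wpDr.
move=> y z y1 z1; have [py pyz] := IH y z y1 z1; rewrite !hornerE.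
have y0 := normc_ge0 y; have z0 := normc_ge0 z; split.
  apply: le_trans (normcD _ _) _; rewrite lerD2r normcM.
  by apply: le_trans py; rewrite ler_piMr ?normc_ge0.
have -> : p.[y] * y + c - (p.[z] * z + c) = p.[y] * (y - z) + (p.[y] - p.[z]) * z.
  by ring.
apply: le_trans (normcD _ _) _; rewrite !normcM mulrDl addrC lerD //.
  by apply: le_trans pyz; rewrite ler_piMr ?normc_ge0.
by rewrite ler_wpM2r ?normc_ge0 // (le_trans py) // ler_norm.
Qed.

(** The second order error in the binomial formula, with a constant that is
    uniform in n as long as [n |h| <= 1]. *)
Lemma expr1D_linear (h : R[i]) n : n%:R * normc h <= 1 ->
  normc ((1 + h) ^+ n - 1 - n%:R * h) <= (n%:R * normc h) ^+ 2.
Proof.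
have h0 := normc_ge0 h; elim: n => [|n IH].
  by rewrite !mul0r expr0 subr0 subrr normc0 expr2 mulr0.
rewrite -natr1 => nh; have nh' : n%:R * normc h <= 1 by lra.
have {}IH := IH nh'.
have -> : (1 + h) ^+ n.+1 - 1 - n.+1%:R * h =
    ((1 + h) ^+ n - 1 - n%:R * h) * (1 + h) + n%:R * h * h.
  by rewrite exprS -natr1; ring.
apply: le_trans (normcD _ _) _; rewrite !normcM.
have hn : normc (n%:R : R[i]) = n%:R.
  by rewrite -(rmorph_nat (real_complex R)) normc_real normr_nat.
rewrite hn.
have h1 : normc (1 + h) <= 1 + normc h.
  by apply: le_trans (normcD _ _) _; rewrite normc1.
have n0 : 0 <= n%:R :> R by exact: ler0n.
have : normc ((1 + h) ^+ n - 1 - n%:R * h) * normc (1 + h) <=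
    (n%:R * normc h) ^+ 2 * (1 + normc h).
  by apply: ler_pM; rewrite ?normc_ge0.
move: (normc _ * _) (normc h) h0 nh nh' n0 => T t t0 nt nt' n0 le.
have : n%:R * n%:R * t * (t * t) <= 1 * n%:R * (t * t).
  rewrite ler_wpM2r ?mulr_ge0 // mulrAC ler_wpM2r //.
have := mulr_ge0 t0 t0; nra.
Qed.

End Modulus.

(** * Rotations of finite order *)
Section UnitCircle.
Variable R : realType.
Implicit Types (x t : R).

Definition expi x : R[i] := Complex (cos x) (sin x).

Lemma normc_expi x : normc (expi x) = 1.
Proof. by rewrite /= cos2Dsin2 sqrtr1. Qed.

Lemma expiD x t : expi (x + t) = expi x * expi t.
Proof.
by apply/eqP; rewrite eq_complex /= cosD sinD eqxx /= addrC eqxx.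
Qed.

Lemma expi0 : expi 0 = 1.
Proof. by rewrite /expi cos0 sin0. Qed.

Lemma expiX x n : expi x ^+ n = expi (n%:R * x).
Proof.
elim: n => [|n IH]; first by rewrite expr0 mul0r expi0.
by rewrite exprS IH -expiD -natr1; congr expi; ring.
Qed.

Lemma normc_le_ReIm (z : R[i]) : normc z <= `|complex.Re z| + `|complex.Im z|.
Proof.
rewrite {1}[z]complexE; apply: le_trans (normcD _ _) _.
rewrite normcM !normc_real (_ : normc _ = 1) ?mul1r //.
by rewrite /= expr0n /= expr1n add0r sqrtr1.
Qed.

Lemma expi_continuous x (e : R) : 0 < e ->
  exists2 d, 0 < d & forall t, `|t - x| < d -> normc (expi t - expi x) < e.
Proof.
move=> e0; have e20 : 0 < e / 2 by lra.
have /cvgrPdist_lt/(_ _ e20)/nbhs_ballP[d1 /= d10 H1] := @continuous_cos R x.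
have /cvgrPdist_lt/(_ _ e20)/nbhs_ballP[d2 /= d20 H2] := @continuous_sin R x.
exists (Num.min d1 d2); first by rewrite lt_min d10.
move=> t; rewrite lt_min => /andP[t1 t2].
have c1 : `|cos x - cos t| < e / 2 by apply: H1; rewrite /ball /= distrC.
have c2 : `|sin x - sin t| < e / 2 by apply: H2; rewrite /ball /= distrC.
by apply: le_lt_trans (normc_le_ReIm (expi t - expi x)) _; rewrite /= distrC [`|sin t - _|]distrC; lra.
Qed.

Lemma unit_polar (p : R[i]) : normc p = 1 -> exists2 t, `|t| <= pi & p = expi t.
Proof.
case: p => a b /= /(congr1 (fun x => x ^+ 2)); rewrite expr1n sqr_sqrtr; last first.
  by rewrite addr_ge0 ?sqr_ge0.
move=> ab; have a1 : -1 <= a <= 1.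
  by apply/andP; have := sqr_ge0 b; split; nra.
have b2 : 1 - a ^+ 2 = b ^+ 2 by rewrite -ab; ring.
have pa : `|acos a| <= pi by rewrite ger0_norm ?acos_ge0 // acos_lepi.
have ca : cos (acos a) = a by rewrite acosK // in_itv.
have [b0|b0] := leP 0 b.
  by exists (acos a) => //; rewrite /expi ca sin_acos // b2 sqrtr_sqr ger0_norm.
exists (- acos a); rewrite ?normrN //.
by rewrite /expi cosN sinN ca sin_acos // b2 sqrtr_sqr ltr0_norm // opprK.
Qed.

(** Uniformity in the target p is essential: the order m is fixed before the
    point whose argument has to be corrected. *)
Lemma unit_root_near1 (e : R) : 0 < e -> exists N, forall m, (N <= m)%N ->
  forall p : R[i], normc p = 1 ->
  exists q, [/\ normc q = 1, q ^+ m = p & normc (q - 1) < e].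
Proof.
move=> e0; have [d d0 H] := expi_continuous 0 e0.
exists (Num.bound (pi / d)).+1 => m Nm p p1; have [t tpi ->] := unit_polar p1.
have m0 : 0 < m%:R :> R by rewrite ltr0n; apply: leq_trans Nm.
exists (expi (t / m%:R)); split; first exact: normc_expi.
  by rewrite expiX mulrCA divff ?mulr1 // gt_eqF.
rewrite -expi0; apply: H; rewrite subr0 normrM normfV (gtr0_norm m0).
rewrite ltr_pdivrMr // (le_lt_trans tpi) // -ltr_pdivrMl // mulrC.
apply: lt_le_trans (unstable.ltr_bound _) _.
by rewrite ler_nat; apply: leq_trans Nm.
Qed.

(** Choose the angle x as a rational multiple of a full turn close to
    [acos (1 - t / 2)]. *)
Lemma finite_order_trace_dense t (e : R) : 0 < t < 4 -> 0 < e ->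
  exists k x, [/\ (0 < k)%N, sin x != 0, expi (k%:R * x) = 1 &
    `|2 * cos x - 2 + t| < e].
Proof.
move=> /andP[t0 t4] e0; set x0 := acos (1 - t / 2).
have x0r : 0 < x0 < pi by rewrite acos_gt0 ?acos_ltpi //; lra.
have cx0 : cos x0 = 1 - t / 2 by rewrite acosK // in_itv /=; lra.
have e20 : 0 < e / 2 by lra.
have /cvgrPdist_lt/(_ _ e20)/nbhs_ballP[d /= d0 H] := @continuous_cos R x0.
have pi0 := pi_gt0 R.
have pi20 : 0 < pi *+ 2 :> R by rewrite pmulrn_lgt0.
have [|q] := @rat_in_itvoo R (x0 / (pi *+ 2)) (Num.min (x0 + d) pi / (pi *+ 2)).
  by rewrite ltr_pM2r ?invr_gt0 // lt_min; apply/andP; split; lra.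
rewrite in_itv /= => /andP[]; rewrite ltr_pdivrMr // ltr_pdivlMr // lt_min.
move=> xq /andP[qd qpi].
set x := ratr q * (pi *+ 2) in xq qd qpi.
have q0 : 0 < q.
  rewrite -(ltr0q R); have : 0 < x by lra.
  by rewrite /x pmulr_lgt0.
exists `|denq q|%N, x; split.
- by rewrite absz_gt0 denq_neq0.
- by rewrite gt_eqF // sin_gt0_pi //; lra.
- have -> : `|denq q|%:R * x = `|numq q|%:R * (pi *+ 2).
    rewrite /x mulrA; congr (_ * _).
    rewrite -[in ratr q](divq_num_den q) fmorph_div /= !ratr_int.
    rewrite !pmulrn !gez0_abs ?ltW ?denq_gt0 ?numq_gt0 //.
    by rewrite mulrCA divff ?mulr1 // intr_eq0 denq_neq0.
  by rewrite -expiX /expi cos2pi sin2pi (_ : Complex 1 0 = 1) // expr1n.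
- have : `|cos x0 - cos x| < e / 2.
    by apply: H; rewrite /ball /= distrC gtr0_norm; lra.
  rewrite cx0 => h; have -> : 2 * cos x - 2 + t = - (2 * (1 - t / 2 - cos x)) by lra.
  by rewrite normrN normrM ger0_norm //; lra.
Qed.

End UnitCircle.

(** * Superattracting fixed points *)
Section Superattracting.
Variable R : realType.
Implicit Types (z w : R[i]) (u q : {poly R[i]}).

Lemma normc_nat n : normc (n%:R : R[i]) = n%:R.
Proof. by rewrite -(rmorph_nat (real_complex R)) normc_real normr_nat. Qed.

(** Close to 0 the polynomial [z^m u(z)] behaves like a multiple of the power
    map: moving z by a relative distance r moves the image by a relative
    distance of about [m r], so the image of the disc of relative radius r
    contains a disc of relative radius at least [3/2 r].  The bound
    [m r <= 1/2] keeps the binomial formula in its linear regime, and [8 <= m]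
    leaves room for the factor 3 in the estimate on the circle. *)
Lemma superattracting_covering u m (k : R) :
  u.[0] != 0 -> (8 <= m)%N -> 0 < k ->
  exists2 e : R, 0 < e & forall z, 0 < normc z < e ->
  let q := 'X^m * u in
  [/\ 0 < normc q.[z] <= normc z,
      forall r, 0 < r -> m%:R * r <= 2^-1 ->
        forall w, 2 * normc (w - q.[z]) < 3 * r * normc q.[z] ->
        exists2 y, normc (y - z) < r * normc z & q.[y] = w &
      forall n, normc n = 1 ->
        normc (q.[z * n] - n ^+ m * q.[z]) <= k * normc q.[z]].
Proof.
move=> u0 m8 k0; have [L L0 HL] := poly_lipschitz u.
set v0 := normc u.[0]; have v00 : 0 < v0 by rewrite normc_gt0.
pose e1 : R := 4^-1; pose e2 := v0 / (100 * L); pose e3 := k * v0 / (4 * L).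
pose e4 := (2 * v0)^-1.
(* e2 makes u nearly constant, e3 controls the third claim, and e4 makes the
   polynomial decrease moduli. *)
exists (Num.min (Num.min e1 e2) (Num.min e3 e4)).
  by rewrite !lt_min /e1 /e2 /e3 /e4 !divr_gt0 ?invr_gt0 ?mulr_gt0 //; lra.
move=> z; rewrite !lt_min => /andP[z0 /andP[/andP[z1 z2] /andP[z3 z4]]] q.
have {}z1 : normc z <= 4^-1 by exact: ltW.
have {}z2 : L * normc z <= v0 / 100.
  move: z2; rewrite /e2 ltr_pdivlMr ?mulr_gt0 //; lra.
have {}z3 : 4 * (L * normc z) <= k * v0.
  move: z3; rewrite /e3 ltr_pdivlMr ?mulr_gt0 //; lra.
have {}z4 : 2 * (v0 * normc z) <= 1.
  move: z4; rewrite /e4 -[_^-1]mul1r ltr_pdivlMr ?mulr_gt0 //; lra.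
have uz : `|normc u.[z] - v0| <= v0 / 100.
  have h : normc (u.[z] - u.[0]) <= v0 / 100.
    apply: le_trans z2; rewrite -{2}[z]subr0; apply: HL; last by rewrite normc0.
    lra.
  rewrite ler_norml; apply/andP; split.
    have := normc_geB u.[0] u.[z]; rewrite normcB -/v0; lra.
  have := normc_geB u.[z] u.[0]; rewrite -/v0; lra.
have qE y : q.[y] = y ^+ m * u.[y] by rewrite hornerM hornerXn.
have uzl : 99 / 100 * v0 <= normc u.[z] by move: uz; rewrite ler_norml; lra.
have uzu : normc u.[z] <= 101 / 100 * v0 by move: uz; rewrite ler_norml; lra.
have uz0 : 0 < normc u.[z] by lra.
have qz : normc q.[z] = normc z ^+ m * normc u.[z] by rewrite qE normcM normcX.
have zm0 : 0 < normc z ^+ m by rewrite exprn_gt0.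
have qz0 : 0 < normc q.[z] by rewrite qz mulr_gt0.
split.
- rewrite qz0 /= qz.
  have zm : normc z ^+ m <= normc z * normc z.
    rewrite -expr2; apply: ler_wiXn2l; rewrite ?normc_ge0 //; last exact: leq_trans m8.
    lra.
  apply: le_trans (ler_wpM2r (ltW uz0) zm) _.
  rewrite -mulrA ler_piMr ?normc_ge0 //.
  have : normc z * normc u.[z] <= normc z * (101 / 100 * v0) by rewrite ler_wpM2l // ltW.
  lra.
- move=> r r0 mr w wq.
  have m8' : 8 <= m%:R :> R by rewrite ler_nat.
  have r16 : r <= 16^-1.
    have : 8 * r <= m%:R * r by rewrite ler_wpM2r // ltW.
    lra.
  have z_neq0 : z != 0 by rewrite -normc_gt0.
  pose G := q - w%:P.
  have [|||y yr q0] := @root_in_disc _ z (r * normc z) _ G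
      (3 * r * normc q.[z] - normc (w - q.[z])).
  + by rewrite mulr_gt0.
  + by rewrite /G hornerD hornerN hornerC normcB; lra.
  + move=> y yz; rewrite /G hornerD hornerN hornerC.
    pose h := (y - z) / z.
    have hr : normc h = r.
      by rewrite normcM normcV yz mulfK // gt_eqF.
    have yE : y = z * (1 + h) by rewrite /h; field.
    have y1 : normc y <= 1.
      rewrite yE normcM; apply: (@le_trans _ _ (4^-1 * 2)); last lra.
      rewrite ler_pM ?normc_ge0 //; apply: le_trans (normcD _ _) _.
      rewrite normc1 hr; lra.
    have uyz : normc (u.[y] - u.[z]) <= r * (v0 / 100).
      apply: (@le_trans _ _ (L * normc (y - z))); first by apply: HL => //; lra.
      by rewrite yz mulrCA ler_wpM2l // ltW.
    have uy : normc u.[z] - r * (v0 / 100) <= normc u.[y].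
      have := normc_geB u.[z] u.[y]; rewrite normcB; lra.
    (* m r - (m r)^2 >= m r / 2 >= 4 r. *)
    have hm : 4 * r <= normc ((1 + h) ^+ m - 1).
      have : m%:R * normc h <= 1 by rewrite hr; lra.
      move/(@expr1D_linear R h m); rewrite hr => hl.
      have := normc_geB (m%:R * h) (m%:R * h - ((1 + h) ^+ m - 1)).
      rewrite subKr normcM normc_nat hr [X in _ - X]normcB => hg.
      have : (m%:R * r) ^+ 2 <= 2^-1 * (m%:R * r).
        by rewrite expr2 ler_wpM2r // mulr_ge0 // ltW.
      have : 8 * r <= m%:R * r by rewrite ler_wpM2r // ltW.
      lra.
    have main : 3 * r * normc u.[z] <=
        normc (((1 + h) ^+ m - 1) * u.[y] + (u.[y] - u.[z])).
      have := normc_geB (((1 + h) ^+ m - 1) * u.[y]) (- (u.[y] - u.[z])).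
      rewrite opprK normc_opp normcM => hg.
      have : 4 * r * normc u.[y] <= normc ((1 + h) ^+ m - 1) * normc u.[y].
        by rewrite ler_wpM2r // normc_ge0.
      have : 4 * r * (normc u.[z] - r * (v0 / 100)) <= 4 * r * normc u.[y].
        by rewrite ler_wpM2l //; lra.
      have : r * (r * v0) <= r * (16^-1 * v0).
        by rewrite ler_wpM2l ?ler_wpM2r //; lra.
      have : r * (99 / 100 * v0) <= r * normc u.[z] by rewrite ler_wpM2l // ltW.
      have := mulr_gt0 r0 v00; lra.
    have dq : q.[y] - q.[z] =
        z ^+ m * (((1 + h) ^+ m - 1) * u.[y] + (u.[y] - u.[z])).
      by rewrite !qE [in y ^+ m]yE exprMn; ring.
    have : 3 * r * normc q.[z] <= normc (q.[y] - q.[z]).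
      rewrite dq normcM normcX qz.
      by rewrite mulrCA ler_wpM2l // ltW.
    have := normc_geB (q.[y] - q.[z]) (w - q.[z]).
    rewrite (_ : q.[y] - q.[z] - (w - q.[z]) = q.[y] - w); last by ring.
    lra.
  exists y => //; apply/eqP; rewrite -subr_eq0.
  by move: q0; rewrite /root /G hornerD hornerN hornerC.
- move=> n n1; have -> : q.[z * n] - n ^+ m * q.[z] =
      z ^+ m * n ^+ m * (u.[z * n] - u.[z]).
    by rewrite !qE exprMn; ring.
  rewrite normcM normcM !normcX n1 expr1n mulr1 qz mulrCA ler_wpM2l ?(ltW zm0) //.
  apply: le_trans (HL _ _ _ _) _; rewrite ?normcM ?n1 ?mulr1; try lra.
  have : normc (z * n - z) <= 2 * normc z.
    by apply: le_trans (normcD _ _) _; rewrite normcM normc_opp n1; lra.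
  move/(ler_wpM2l (ltW L0)).
  have : k * (99 / 100 * v0) <= k * normc u.[z] by rewrite ler_wpM2l // ltW.
  have : 0 < k * v0 by rewrite mulr_gt0.
  lra.
Qed.

Section Density.
Variables (S : R[i] -> Prop) (Q : {poly R[i]} -> Prop).
Hypothesis S0 : S 0.
Hypothesis S_neg : forall t e : R, 0 < t < 4 -> 0 < e ->
  exists2 s, S s & normc (s + (t%:C)%C) < e.
Hypothesis S_pull : forall q z, Q q -> S q.[z] -> S z.
Hypothesis Q_super : forall n, exists m u,
  [/\ (n <= m)%N, u.[0] != 0 & Q ('X^m * u)].

Definition avoids z (r : R) := forall y, normc (y - z) < r * normc z -> ~ S y.

(** If S met the disc of relative radius [3/2 r] around the image of z, pulling
    back along the covering would produce a point of S in the disc of relative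
    radius r around z.  Iterating, the radius grows until the covering lemma
    stops applying. *)
Lemma avoids_grow u m : u.[0] != 0 -> (8 <= m)%N -> Q ('X^m * u) ->
  exists2 e : R, 0 < e & forall z r, 0 < normc z < e -> 0 < r -> avoids z r ->
  exists z', 0 < normc z' <= normc z /\ avoids z' (2 * m%:R)^-1.
Proof.
move=> u0 m8 Qq; set c := (2 * m%:R)^-1.
have [e e0 H] := superattracting_covering u0 m8 (ltr01 : 0 < 1 :> R).
exists e => // z r ze r0 zr.
have m0 : 0 < m%:R :> R by rewrite ltr0n (leq_trans _ m8).
have c0 : 0 < c by rewrite invr_gt0 mulr_gt0.
have mc : m%:R * c = 2^-1 by rewrite /c; field; rewrite gt_eqF.
have iter n : exists z', 0 < normc z' <= normc z /\
    avoids z' (Num.min ((3 / 2) ^+ n * r) c); last first.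
  have [|n hn] := @expr_unbounded _ (3 / 2 : R) (c / r); first lra.
  have [z' [z'e z'r]] := iter n; exists z'; split=> //.
  by move: z'r; rewrite min_r // -ler_pdivrMr // ltW.
elim: n => [|n [z' [/andP[z'0 z'z] z'r]]].
  exists z; split; first by case/andP: ze => -> _ /=.
  move=> y; rewrite expr0 mul1r => yz; apply: zr.
  by apply: lt_le_trans yz _; rewrite ler_wpM2r ?normc_ge0 // ge_min lexx.
have z'e : 0 < normc z' < e by rewrite z'0 (le_lt_trans z'z) //; case/andP: ze.
have [/andP[q0 qz] cover _] := H z' z'e.
exists ('X^m * u).[z']; split; first by rewrite q0 (le_trans qz).
set r' := Num.min _ c in z'r.
have r'0 : 0 < r' by rewrite lt_min c0 mulr_gt0 ?exprn_gt0 //; lra.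
have r'c : m%:R * r' <= 2^-1.
  by rewrite -mc ler_wpM2l ?(ltW m0) // ge_min lexx orbT.
move=> w wq Sw; have [|y yz qy] := cover r' r'0 r'c w.
  suff : Num.min ((3 / 2) ^+ n.+1 * r) c <= 3 / 2 * r'.
    by move/(ler_wpM2r (ltW q0)); lra.
  rewrite /r' minr_pMr; last lra.
  rewrite le_min !ge_min exprS mulrA lexx /=; apply/orP; right; lra.
by apply: (z'r y yz); apply: (S_pull Qq); rewrite qy.
Qed.

(** A disc missing S would grow to a fixed relative radius c.  A polynomial q
    whose order m2 is large compared with [1 / c] allows to rotate the centre z
    within half that disc so that its image gets close to the negative real
    [- |q z|]; the covering property of q then reaches a point of S. *)
Lemma dense_near_zero : exists2 e : R, 0 < e & forall z, normc z < e ->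
  forall d, 0 < d -> exists2 y, normc (y - z) < d & S y.
Proof.
have [m1 [u1 [m18 u10 Q1]]] := Q_super 8.
have [e1 e10 H1] := avoids_grow u10 m18 Q1.
set c : R := (2 * m1%:R)^-1 in H1.
have m10 : 0 < m1%:R :> R by rewrite ltr0n (leq_trans _ m18).
have c0 : 0 < c by rewrite invr_gt0 mulr_gt0.
have [|N HN] := @unit_root_near1 R (c / 2); first by rewrite divr_gt0.
have [m2 [u2 [m2N u20 Q2]]] := Q_super (maxn N (2 * m1)).
have m28 : (8 <= m2)%N.
  by move: m2N; rewrite geq_max => /andP[_]; lia.
have m20 : 0 < m2%:R :> R by rewrite ltr0n (leq_trans _ m28).
set r : R := (2 * m2%:R)^-1.
have r0 : 0 < r by rewrite invr_gt0 mulr_gt0.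
have m2r : m2%:R * r <= 2^-1.
  by rewrite (_ : _ * r = 2^-1) // /r; field; rewrite gt_eqF.
have rc : r <= c / 2.
  have m12 : 2 * m1%:R <= m2%:R :> R.
    by rewrite -natrM ler_nat (leq_trans _ m2N) // leq_max leqnn orbT.
  by rewrite /r /c -invfM lef_pV2 ?posrE ?mulr_gt0 //; lra.
have k0 : 0 < r / 4 by lra.
have [e2 e20 H2] := superattracting_covering u20 m28 k0.
pose e3 := Num.min e2 1.
exists (Num.min e1 e3); first by rewrite !lt_min e10 e20 ltr01.
move=> z0; rewrite !lt_min => /andP[z01 /andP[z02 z03]] d d0.
apply: contrapT => no; have Sno y : normc (y - z0) < d -> ~ S y.
  by move=> yd Sy; apply: no; exists y.
have z00 : 0 < normc z0.
  rewrite normc_gt0; apply/eqP => z00; apply: (Sno z0) => //.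
    by rewrite subrr normc0.
  by rewrite z00.
have dz0 : 0 < d / normc z0 by rewrite divr_gt0.
have [||z [/andP[zp zz0] zc]] := H1 z0 _ _ dz0; first by rewrite z00.
  by move=> y; rewrite divfK ?gt_eqF //; apply: Sno.
have z2 : 0 < normc z < e2 by rewrite zp (le_lt_trans zz0).
have [/andP[q0 qz] _ rot] := H2 z z2.
set q := 'X^m2 * u2 in Q2 q0 qz rot.
(* p is the rotation that takes the image of z to the negative real axis, and n
   an m2-th root of p close to 1. *)
pose t := normc q.[z]; pose p : R[i] := - (t%:C)%C / q.[z].
have qz_neq0 : q.[z] != 0 by rewrite -normc_gt0.
have p1 : normc p = 1.
  by rewrite normcM normc_opp normc_real normcV ger0_norm ?normc_ge0 // divff ?gt_eqF.
have [|n [n1 np nc]] := HN m2 _ p p1.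
  by apply: leq_trans m2N; rewrite leq_max leqnn.
have zn : normc (z * n) = normc z by rewrite normcM n1 mulr1.
have zn2 : 0 < normc (z * n) < e2 by rewrite zn.
have [/andP[qn0 _] cover _] := H2 (z * n) zn2.
have {rot} := rot n n1; rewrite np /p divfK // opprK -/t => rot.
have t4 : 0 < t < 4.
  rewrite q0 (le_lt_trans qz) // (le_lt_trans zz0) // (lt_trans z03) //; lra.
have rt : 0 < r / 4 * t by rewrite mulr_gt0.
have [s Ss st] := S_neg t4 rt.
have tn : (1 - r / 4) * t <= normc q.[z * n].
  have := normc_geB (t%:C)%C (q.[z * n] + (t%:C)%C).
  rewrite opprD addrCA subrr addr0 normc_opp normc_real ger0_norm ?normc_ge0 //; lra.
have [|y yz qy] := cover r r0 m2r s.
  have : normc (s - q.[z * n]) <= normc (s + (t%:C)%C) + normc (q.[z * n] + (t%:C)%C).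
    rewrite -(normc_opp (q.[z * n] + _)); apply: le_trans (normcD _ _).
    by rewrite opprD addrACA subrr addr0.
  have r1 : r <= 1 / 8.
    have : 8 * r <= m2%:R * r by rewrite ler_wpM2r ?ler_nat // ltW.
    lra.
  have : 3 * r * ((1 - r / 4) * t) <= 3 * r * normc q.[z * n].
    by rewrite ler_wpM2l // mulr_ge0 // ltW.
  have : r * (r * t) <= r * (1 / 8 * t).
    by rewrite ler_wpM2l ?(ltW r0) // ler_wpM2r // normc_ge0.
  have rt' : 0 < r * t by rewrite mulr_gt0.
  nra.
apply: (zc y); last by apply: (S_pull Q2); rewrite qy.
have -> : y - z = (y - z * n) + z * (n - 1) by ring.
apply: le_lt_trans (normcD _ _) _; rewrite normcM.
have : normc z * normc (n - 1) <= normc z * (c / 2) by rewrite ler_wpM2l // ltW.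
have : r * normc z <= c / 2 * normc z by rewrite ler_wpM2r // ltW.
rewrite zn in yz; lra.
Qed.

End Density.

End Superattracting.

(** * Density of the roots near zero *)

(** The word [b a b^-1 a b a^-2 b^-1 a b a b^-1].  Up to a power of a it is the
    product of the conjugates of [b, b^-1, b, b^-1, b, b^-1] by
    [1, a, a^2, 1, a, a^2]: each of the three conjugates of b occurs once with
    either sign. *)
Definition super_exps : seq int := [:: 1; 1; -2; 1; 1].

(** Let f be diagonal.  If g is unipotent and triangular, the three conjugates of
    g commute and the word collapses to a power of f.  This holds for both kinds
    of triangular matrices, so near [gamma f g = 0] both off-diagonal entries of
    the word are of higher order, and [gamma f] of the word, a multiple of their
    product, vanishes to second order. *)
Lemma trace_val_super (T : comNzRingType) (x z : T) :
  exists u, trace_val x z super_exps = z ^+ 2 * u.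
Proof.
exists (z * (- 9 * x ^+ 2 - 4 * x - 6 * x ^+ 3 - x ^+ 4
  + (17 * x + 4 + 16 * x ^+ 2 + 3 * x ^+ 3) * z
  - (14 * x + 3 * x ^+ 2 + 8) * z ^+ 2 + (4 + x) * z ^+ 3)).
rewrite /super_exps /trace_val /word_coords /conj_az /= /conj_b /conj_a /conj_aV.
ring.
Qed.

Lemma expgz1 (G : groupType) (a : G) : expgz a 1 = a.
Proof. exact: expg1. Qed.

Section WordFamily.
Variable R : realType.
Variable b0 : R[i].
Implicit Types (z : R[i]) (rs vs : seq int).
Local Notation wp := (word_poly b0).

Lemma word_polyX rs : wp rs = trace_val (b0%:P) 'X rs.
Proof.
pose phi : {rmorphism {poly {poly int}} -> {poly R[i]}} :=
  map_poly (horner_eval b0 \o map_poly intr).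
rewrite -[LHS]/(phi (trace_poly rs)) rmorph_trace_val /phi /=.
by rewrite map_polyX map_polyC /= map_polyX /horner_eval hornerX.
Qed.

(** Composing with the superattracting polynomial doubles the order of
    vanishing at 0. *)
Lemma word_poly_high_order n : wp super_exps != 0 ->
  exists m u rs, [/\ (n <= m)%N, u.[0] != 0, wp rs = 'X^m * u & wp rs != 0].
Proof.
move=> q0; have [v qv] : exists v, wp super_exps = 'X^2 * v.
  by have [v Ev] := trace_val_super (b0%:P) 'X; exists v; rewrite word_polyX Ev.
have [rs [rs0 [p rsp]]] : exists rs, wp rs != 0 /\ exists p, wp rs = 'X^(2 ^ n) * p.
  elim: n => [|n [rs [rs0 [p rsp]]]].
    by exists super_exps; split=> //; exists ('X * v); rewrite qv expn0 expr1 expr2 mulrA.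
  exists (subst_exps false super_exps rs); split.
    exact: word_poly_subst_neq0.
  rewrite word_poly_subst qv comp_polyM comp_Xn_poly rsp.
  exists (p ^+ 2 * (v \Po ('X^(2 ^ n) * p))).
  by rewrite exprMn -exprM mulrA -expnSr.
have [m [u]] := multiplicity_XsubC (wp rs) 0.
rewrite rs0 /= subr0 mulrC => ru E; exists m, u, rs; split => //.
rewrite leqNgt; apply: contra ru => mn.
have m2 : (m < 2 ^ n)%N by rewrite (ltn_trans mn) // ltn_expl.
have -> : u = 'X^(2 ^ n - m) * p.
  apply: (mulfI (expf_neq0 m (negbT (polyX_eq0 R[i])))).
  by rewrite -E rsp mulrA -exprD subnKC // ltnW.
by rewrite /root hornerM hornerXn expr0n subn_eq0 leqNgt m2 mul0r.
Qed.

(** The powers of the commutator of f and g are good words, up to a power of f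
    on the left. *)
Fixpoint comm_exps n : seq int :=
  if n is n'.+1 then [:: -1, 1 & comm_exps n'] else [:: -1].

Lemma eval_comm_exps (G : groupType) (f g : G) n :
  eval_alternating false (comm_exps n) f g =
  (f^-1 * (f * g * f^-1 * g^-1) ^+ n.+1)%g.
Proof.
elim: n => [|n IH]; first by rewrite /= ?expg1 !mulgA mulVg mul1g ?expg1.
rewrite [LHS]/= IH /expgz expg1 [in RHS]expgS !mulgA mulVg mul1g.
by rewrite -[(_ * f * f^-1)%g]mulgA mulgV mulg1.
Qed.

(** By Cayley-Hamilton [sin x M^n = sin (n x) M - sin (n x - x)]. *)
Lemma SL2_rotation_power (M : SL2 R[i]) (x : R) k : (0 < k)%N ->
  \tr M = ((2 * cos x)%:C)%C -> sin x != 0 -> expi (k%:R * x) = 1 ->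
  (M ^+ k)%g = 1%g.
Proof.
move=> k0 tM sx [ck sk].
have E n : ((sin x)%:C)%C *: SL2mx (M ^+ n)%g =
    ((sin (n%:R * x))%:C)%C *: SL2mx M - ((sin (n%:R * x - x))%:C)%C%:M.
  elim: n => [|n IH].
    rewrite mul0r sin0 scale0r sub0r sub0r sinN expg0.
    by rewrite -scalemx1 -scaleNr -rmorphN opprK.
  rewrite expgS SL2_mulE scalemxAr IH mulmxBr -scalemxAr SL2_CH mul_mx_scalar tM.
  have -> : n.+1%:R * x - x = n%:R * x by rewrite -natr1; ring.
  have -> : sin (n.+1%:R * x) = sin (n%:R * x) * (2 * cos x) - sin (n%:R * x - x).
    rewrite -natr1 mulrDl mul1r sinD sinB; ring.
  rewrite rmorphB rmorphM /=.
  by apply/matrixP => i j; rewrite !mxE; case: (i == j);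
    rewrite /= ?mulr1n ?mulr0n; ring.
apply: val_inj => /=.
have sC : ((sin x)%:C)%C != 0 by rewrite -normc_eq0 normc_real normr_eq0.
apply: (scalerI sC); rewrite [LHS]E sk scale0r sub0r sinB sk ck mul0r mul1r sub0r.
by rewrite rmorphN raddfN opprK scalemx1.
Qed.

(** Where [gamma f g = 2 cos x - 2], the commutator of f and g has trace
    [2 cos x], hence a power of it is trivial; the corresponding good word is
    then [f^-1], which commutes with f. *)
Lemma word_root_rotation (A : SL2 R[i]) (x : R) k : beta (mobius A) = b0 ->
  mobius A <> 1%g -> (0 < k)%N -> sin x != 0 -> expi (k%:R * x) = 1 ->
  word_root b0 ((2 * cos x - 2)%:C)%C.
Proof.
case: k => // k bA A1 _ sx kx; exists (comm_exps k).
  rewrite -bA beta_mobius; apply: word_poly_neq0 => r.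
  have e1 : expgz (mobius A) (-1) != 1%g.
    by rewrite expgzN invg_eq1 expgz1; apply/eqP.
  have e2 : expgz (mobius A) 1 != 1%g by rewrite expgz1; apply/eqP.
  elim: k {kx} => [|k IH]; first by rewrite inE => /eqP ->.
  by rewrite !inE => /or3P[/eqP->|/eqP->|].
have [f [g [fb fg]]] := beta_gamma_surj b0 ((2 * cos x - 2)%:C)%C.
rewrite /root -fg (word_polyE _ false _ fb) eval_comm_exps.
have [F fF] := mobius_surj f; have [G gG] := mobius_surj g.
have M1 : ((F * G * F^-1 * G^-1) ^+ k.+1 = 1)%g.
  apply: SL2_rotation_power sx kx => //.
  by move: fg; rewrite fF gG gamma_mobius => /eqP; rewrite subr_eq => /eqP ->;
    rewrite rmorphB /= rmorph_nat subrK.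
have -> : ((f * g * f^-1 * g^-1) ^+ k.+1 = 1)%g.
  by rewrite fF gG -!mobiusV -!mobiusM -[(_ ^+ _)%g]/(expgz _ k.+1) -mobiusX /expgz M1.
rewrite mulg1 fF -mobiusV; apply/eqP/gamma_commute.
exact/commuteV/commute_refl.
Qed.

(** The exponents of the word are 1 and -2, and an f with [f^2 = 1] and
    [f <> 1] has trace zero, that is, beta = -4. *)
Lemma super_neq0 (A : SL2 R[i]) : beta (mobius A) = b0 -> b0 != -4 ->
  mobius A <> 1%g -> wp super_exps != 0.
Proof.
move=> bA b4 A1; rewrite -bA beta_mobius; apply: word_poly_neq0 => r.
have e1 : expgz (mobius A) 1 != 1%g by rewrite expgz1; apply/eqP.
have e2 : (mobius A ^+ 2)%g != 1%g.
  apply/eqP; rewrite -[(_ ^+ 2)%g]/(expgz _ 2%:Z) -mobiusX => /mobius_eq1.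
  rewrite /expgz expgS expg1 SL2_mulE SL2_CH => AA.
  have [c Ac] : exists c : R[i], \tr A *: SL2mx A = c%:M.
    case: AA => /eqP; rewrite subr_eq => /eqP ->.
      by exists (1 + 1); rewrite raddfD.
    by exists 0; rewrite addNr raddf0.
  have t0 : \tr A != 0.
    by apply: contra b4 => /eqP t0; rewrite -bA beta_mobius t0 expr0n sub0r.
  have AE : SL2mx A = (c / \tr A)%:M.
    by apply: (scalerI t0); rewrite Ac scale_scalar_mx mulrC divfK.
  have := det_SL2 A; rewrite AE !mxE /= !mulr1n mulr0n mul0r subr0.
  move/eqP; rewrite -expr2 sqrf_eq1 => /orP[] /eqP cA; apply: A1; apply/mobius_eq1;
    rewrite AE cA; [by left|by right; rewrite raddfN].
by rewrite !inE => /or4P[/eqP->|/eqP->|/eqP->|/orP[] /eqP->] //;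
  rewrite ?expgzN ?invg_eq1 /expgz.
Qed.

Lemma word_root_dense_near0 (A : SL2 R[i]) : beta (mobius A) = b0 -> b0 != -4 ->
  mobius A <> 1%g ->
  exists2 e : R, 0 < e & forall z, normc z < e ->
  forall d, 0 < d -> exists2 y, normc (y - z) < d & word_root b0 y.
Proof.
move=> bA b4 A1; have q0 := super_neq0 bA b4 A1.
apply: (@dense_near_zero R (word_root b0)
  (fun q => exists2 rs, q = wp rs & wp rs != 0)).
- by exists super_exps => //; rewrite /root word_poly0.
- move=> t e t04 e0; have [k [x [k0 sx kx xe]]] := finite_order_trace_dense t04 e0.
  exists ((2 * cos x - 2)%:C)%C; first exact: word_root_rotation bA A1 k0 sx kx.
  by rewrite -rmorphD normc_real.
- by move=> q z [rs -> rs0]; apply: word_root_pull.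
- move=> n; have [m [u [rs [nm u0 E rs0]]]] := word_poly_high_order n q0.
  by exists m, u; split=> //; exists rs; rewrite -?E.
Qed.

(** If all the roots of [q - s] were at distance at least d from z, then
    [|q z - s|] would be at least [|lead_coef q| d^(deg q)]. *)
Lemma poly_open (q : {poly R[i]}) z (d : R) : (1 < size q)%N -> 0 < d ->
  exists2 e : R, 0 < e & forall s, normc (s - q.[z]) < e ->
  exists2 y, normc (y - z) < d & q.[y] = s.
Proof.
move=> q1 d0; exists (normc (lead_coef q) * d ^+ (size q).-1).
  rewrite mulr_gt0 ?exprn_gt0 // normc_gt0 lead_coef_eq0 -size_poly_gt0.
  exact: ltn_trans q1.
move=> s sq; pose p := q - s%:P.
have sp : (size (- s%:P) < size q)%N by rewrite size_polyN (leq_ltn_trans (size_polyC_leq1 _)).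
have ps : size p = size q by rewrite size_polyDl.
have pl : lead_coef p = lead_coef q by rewrite lead_coefDl.
have [rs E] := closed_field_poly_normal p.
have rsz : size rs = (size q).-1.
  by rewrite -ps E size_scale ?size_prod_XsubC // pl lead_coef_eq0 -size_poly_gt0 (ltn_trans _ q1).
have [/hasP[a ars az]|/hasPn no] := boolP (has (fun a => normc (a - z) < d) rs).
  exists a => //; have : root p a by rewrite E rootZ ?root_prod_XsubC //
    pl lead_coef_eq0 -size_poly_gt0 (ltn_trans _ q1).
  by rewrite /root /p hornerD hornerN hornerC subr_eq0 => /eqP.
move: sq; rewrite normcB; have -> : q.[z] - s = p.[z] by rewrite hornerD hornerN hornerC.
rewrite E hornerZ horner_prod normcM normc_prod pl ltr_pM2l; last first.
  by rewrite normc_gt0 lead_coef_eq0 -size_poly_gt0 (ltn_trans _ q1).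
rewrite ltNge => /negP[]; rewrite -rsz -prod_const_seq big_seq [X in _ <= X]big_seq.
apply: ler_prod => a ars; rewrite (ltW d0) hornerXsubC normcB leNgt.
exact: no.
Qed.

End WordFamily.

(** * Normal forms in the generated group *)
Section GeneratedSubgroups.
Variable G : groupType.
Implicit Types (A B : set G) (x y : G).

Lemma subgroup_generated A : subgroup (generated A).
Proof.
split=> [B [[]//]|x y Ax Ay B AB|x Ax B AB].
  by case: (AB) => -[_ BM _] _; apply: BM; [apply: Ax|apply: Ay].
by case: (AB) => -[_ _ BV] _; apply: BV; apply: Ax.
Qed.

Lemma generated_sub A B : subgroup B -> A `<=` B -> generated A `<=` B.
Proof. exact: smallest_sub. Qed.

(** An induction principle: stability under left multiplication by the
    generators and their inverses replaces closure under products. *)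
Lemma generated_stable A B : B 1%g ->
  (forall a x, A a -> B x -> B (a * x)%g /\ B (a^-1 * x)%g) -> generated A `<=` B.
Proof.
move=> B1 BA; pose T : set G := [set h | forall x, B x -> B (h * x)%g /\ B (h^-1 * x)%g].
have sT : subgroup T.
  split=> [x Bx|x y Tx Ty z Bz|x Tx z Bz]; first by rewrite invg1 mul1g.
    rewrite invgM -!mulgA; split; first exact: (Tx _ (Ty _ Bz).1).1.
    exact: (Ty _ (Tx _ Bz).2).2.
  by rewrite invgK; case: (Tx z Bz).
have AT : A `<=` T by move=> a Aa x; apply: BA.
by move=> h /(generated_sub sT AT)/(_ 1%g B1)[]; rewrite mulg1.
Qed.

Lemma generated_union A B : generated (A `|` B) =
  generated (generated A `|` generated B).
Proof.
have sg := @subgroup_generated.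
apply/seteqP; split; apply: generated_sub => //.
  by move=> x [Ax|Bx]; apply: sub_gen_smallest; [left|right]; apply: sub_gen_smallest.
move=> x [] ; apply: generated_sub => // y ?; apply: sub_gen_smallest; [by left|by right].
Qed.

Lemma mulg_expgz x r : (x * expgz x r = expgz x (r + 1))%g.
Proof.
case: r => [n|[|n]].
- by rewrite -PoszD addn1 /expgz expgS.
- by rewrite /expgz expg1 mulgV.
- have -> : Negz n.+1 + 1 = Negz n :> int by rewrite !NegzE; lia.
  by rewrite /expgz expgSr invgM mulVKg.
Qed.

Lemma mulVg_expgz x r : (x^-1 * expgz x r = expgz x (r - 1))%g.
Proof. by apply: (mulgI x); rewrite mulVKg mulg_expgz subrK. Qed.

Lemma generated1P x y : generated [set x] y -> exists r, y = expgz x r.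
Proof.
move: y; apply: (@generated_stable _ (fun y => exists r, y = expgz x r)).
  by exists 0.
move=> _ _ -> [r ->]; split; [exists (r + 1)|exists (r - 1)].
  exact: mulg_expgz.
exact: mulVg_expgz.
Qed.

End GeneratedSubgroups.

Section NormalForms.
Variables (G : groupType) (f g : G).
Hypothesis gg : (g * g = 1)%g.

Let gV : (g^-1 = g)%g.
Proof. by apply: (mulgI g); rewrite mulgV gg. Qed.

(** The sign of the word is irrelevant here since [g^-1 = g]. *)
Definition alternating rs := eval_alternating false rs f g.

Definition reduced (rs : seq int) := forall r, r \in rs -> expgz f r != 1%g.

Lemma reduced_cons r rs : expgz f r != 1%g -> reduced rs -> reduced (r :: rs).
Proof. by move=> r1 rs1 s; rewrite inE => /orP[/eqP->|/rs1]. Qed.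

Lemma alternating_cons r rs :
  alternating (r :: rs) = (g * expgz f r * alternating rs)%g.
Proof.
rewrite /alternating /=; congr (_ * _)%g; elim: rs true => [|s rs IH] [] //=.
by rewrite gV (IH true).
Qed.

Definition normal_form (h : G) : Prop := (exists i, h = expgz f i) \/
  exists i j rs, reduced rs /\ h = (expgz f i * alternating rs * expgz f j)%g.

Lemma generated_normal_form h : generated [set f; g] h -> normal_form h.
Proof.
move: h; apply: (@generated_stable _ _ normal_form).
  by left; exists 0.
have gN x : normal_form x -> normal_form (g * x)%g.
  case=> [[i ->]|[i [j [rs [rs1 ->]]]]].
    by right; exists 0, i, [::]; split=> //; rewrite /alternating /= mul1g.
  have [i1|i1] := eqVneq (expgz f i) 1%g; last first.
    right; exists 0, j, (i :: rs); split; first exact: reduced_cons.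
    by rewrite alternating_cons mul1g !mulgA.
  case: rs rs1 => [|r rs] rs1; rewrite i1 mul1g.
    by left; exists j; rewrite mulgA gg mul1g.
  right; exists r, j, rs; split.
    by move=> s srs; apply: rs1; rewrite inE srs orbT.
  by rewrite alternating_cons !mulgA gg mul1g.
move=> a x [->|->] Nx; last by rewrite gV; split; apply: gN.
case: Nx => [[i ->]|[i [j [rs [rs1 ->]]]]]; split.
- by left; exists (i + 1); rewrite mulg_expgz.
- by left; exists (i - 1); rewrite mulVg_expgz.
- by right; exists (i + 1), j, rs; rewrite !mulgA mulg_expgz.
- by right; exists (i - 1), j, rs; rewrite !mulgA mulVg_expgz.
Qed.

Lemma generated_involution x : generated [set g] x -> x <> 1%g -> x = g.
Proof.
move=> gx x1; have [] // : x = 1%g \/ x = g.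
move: x gx {x1}; apply: (@generated_stable _ _ (fun x => x = 1%g \/ x = g)).
  by left.
by move=> _ x -> [->|->]; rewrite gV ?gg ?mulg1; split; auto.
Qed.

(** A word in normal form of the free product alternates between nontrivial
    powers of f and the letter g, so it is a nontrivial power of f or an
    alternating word with reduced exponents, up to powers of f at both ends. *)
Lemma free_product_of_no_relation :
  (forall i j rs, reduced rs -> (expgz f i * alternating rs * expgz f j)%g <> 1%g) ->
  is_free_product (generated [set f; g]) (generated [set f]) (generated [set g]).
Proof.
move=> no; split; [exact: subgroup_generated|exact: subgroup_generated| |].
  exact: generated_union.
pose starts_with_f p := exists2 i, expgz f i <> 1%g & p = expgz f i \/
  exists j rs, reduced rs /\ p = (expgz f i * (alternating rs * expgz f j))%g.
pose starts_with_g p := exists j rs, reduced rs /\ p = (alternating rs * expgz f j)%g.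
have claim s : reduced_word (generated [set f]) (generated [set g]) s ->
    match s with
    | [::] => True
    | t :: _ => (if t.1 then starts_with_f else starts_with_g) (\prod_(t <- s) t.2)%g
    end.
  elim: s => [//|[b x] s IH] [hs ss].
  have {}IH := IH (conj (fun t ts => hs t (mem_behead ts)) (path_sorted ss)).
  have [/= xH x1] := hs (b, x) (mem_head _ _); rewrite big_cons /=.
  case: b hs ss xH => /= hs ss xH.
    have [i xi] := generated1P xH; exists i; rewrite -?xi //.
    case: s hs ss IH => [|[b y] s] hs ss IH.
      by left; rewrite big_nil mulg1.
    case: b ss IH hs => //= _ [j [rs [rs1 ->]]] _; right.
    by exists j, rs.
  rewrite (generated_involution xH x1).
  case: s hs ss IH => [|[b y] s] hs ss IH.
    by exists 0, [::]; split=> //; rewrite big_nil.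
  case: b ss IH hs => //= _ [i i1 [->|[j [rs [rs1 ->]]]]] _.
    by exists i, [::]; split.
  exists j, (i :: rs); split; first by apply: reduced_cons => //; apply/eqP.
  by rewrite alternating_cons !mulgA.
move=> [//|[b x] s] /claim; move: (\prod_(_ <- _) _)%g => p cp p1.
case: b cp => /=.
  rewrite p1 => -[i i1 [ii|[j [rs [rs1]]]]]; first by case: i1.
  by rewrite mulgA => /esym/no; case.
rewrite p1 => -[j [rs [rs1 E]]]; case: (no 0 j rs rs1).
by rewrite (_ : expgz f 0 = 1%g) // mul1g -E.
Qed.

End NormalForms.

Section Topology.


(** * Groups that are not discrete *)

(** The inverse of a matrix of SL2 is its trace minus itself, so the function
    is a polynomial in the entries of y. *)
Lemma gamma_continuous (C : numFieldType) (A P P' : SL2 C) : continuous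
  (fun y : PSL2 C => (gamma (mobius A) (mobius P * y * mobius P')%g : C^o)).
Proof.
apply/quotient_continuous.
pose h (M : 'M[C]_2) : C^o := \tr (SL2mx A *m SL2mx P *m M *m SL2mx P' *m
   SL2mx A^-1%g *m SL2mx P'^-1%g *m ((\tr M)%:M - M) *m SL2mx P^-1%g) - 2.
have hE : (fun Y : SL2 C => (gamma (mobius A) (mobius P * mobius Y * mobius P')%g
    : C^o)) = (fun Y => h (SL2mx Y)).
  apply/funext => Y; rewrite -!mobiusM gamma_mobius /h.
  by rewrite !invgM -SL2_invE -!SL2_mulE !mulgA.
rewrite (_ : _ \o _ = fun Y => h (SL2mx Y)); last by rewrite -hE.
move=> Y; apply: (@continuous_comp _ _ _ (fun Y : SL2 C => SL2mx Y) h).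
  exact: initial_continuous.
move: (SL2mx Y) => M.
pose ec (F : 'M[C]_2 -> 'M[C]_2) :=
  forall i j : 'I_2, continuous (fun N : 'M[C]_2 => F N i j : C^o).
have ecM F H : ec F -> ec H -> ec (fun N => F N *m H N).
  move=> cF cH i j; rewrite (_ : (fun _ => _) =
    fun N : 'M[C]_2 => F N i 0 * H N 0 j + F N i 1 * H N 1 j); last first.
    by apply/funext => N; rewrite mul_mx2.
  move=> N; exact: (continuousD (continuousM (cF i 0 N) (cH 0 j N))
    (continuousM (cF i 1 N) (cH 1 j N))).
have ec_cst D : ec (fun=> D) by move=> i j; exact: cst_continuous.
have ec_id : ec id by move=> i j; apply: coord_continuous.
have ec_adj : ec (fun N => (\tr N)%:M - N).
  move=> i j; rewrite (_ : (fun _ => _) =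
    fun N : 'M[C]_2 => (N 0 0 + N 1 1) * (i == j)%:R - N i j); last first.
    by apply/funext => N; rewrite !mxE tr_mx2 mulr_natr.
  move=> N; apply: (continuousB _ (ec_id i j N)).
  apply: (continuousM _ (@cst_continuous _ _ _ _)).
  exact: (continuousD (ec_id 0 0 N) (ec_id 1 1 N)).
rewrite /h; apply: (continuousB _ (@cst_continuous _ _ _ _)).
rewrite (_ : (fun _ => _) = fun N : 'M[C]_2 => ((SL2mx A *m SL2mx P *m N *m SL2mx P' *m
   SL2mx A^-1%g *m SL2mx P'^-1%g *m ((\tr N)%:M - N) *m SL2mx P^-1%g) 0 0 +
   (SL2mx A *m SL2mx P *m N *m SL2mx P' *m
   SL2mx A^-1%g *m SL2mx P'^-1%g *m ((\tr N)%:M - N) *m SL2mx P^-1%g) 1 1)); last first.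
  by apply/funext => N; exact: tr_mx2.
have : ec (fun N => SL2mx A *m SL2mx P *m N *m SL2mx P' *m
   SL2mx A^-1%g *m SL2mx P'^-1%g *m ((\tr N)%:M - N) *m SL2mx P^-1%g).
  apply: (ecM _ (fun=> _)); last exact: ec_cst.
  apply: (fun h => ecM _ _ h ec_adj).
  do 3!(apply: (ecM _ (fun=> _)); last exact: ec_cst).
  exact: (ecM _ _ (ec_cst _) ec_id).
by move=> cH; exact: (continuousD (cH 0 0 M) (cH 1 1 M)).
Qed.

Lemma complex_normE (R : rcfType) (z : R[i]) : `|z| = ((normc z)%:C)%C.
Proof. by rewrite normc_def; case: z. Qed.

Lemma gamma_nbhs (R : realType) (A P P' : SL2 R[i]) (x : PSL2 R[i]) (e : R) :
  normc (gamma (mobius A) (mobius P * x * mobius P')%g) < e ->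
  nbhs x [set y | normc (gamma (mobius A) (mobius P * y * mobius P')%g) < e].
Proof.
move=> xe.
have := @gamma_continuous _ A P P' x.
set F := (fun y : PSL2 R[i] => _) => cF.
have /cF : nbhs (F x) [set c : R[i]^o | normc c < e].
  apply/nbhs_ballP; exists (((e - normc (F x))%:C)%C) => /=.
    by rewrite -[0]/((0%:C)%C) ltcR subr_gt0.
  move=> c; rewrite /ball /= distrC complex_normE ltcR => h.
  by have := normc_geB c (F x); rewrite /F in h *; lra.
by [].
Qed.

End Topology.

Section Conclusion.
Variable (R : realType) (A B : SL2 R[i]).
Let f := mobius A.
Let g := mobius B.

Lemma gamma_expgz i h j :
  gamma f (expgz f i * h * expgz f j)%g = gamma f h.
Proof.
have [H ->] := mobius_surj h; rewrite -!mobiusX.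
have -> : (mobius (expgz A i) * mobius H * mobius (expgz A j))%g =
    mobius (expgz A i * H * expgz A j)%g by rewrite !mobiusM.
rewrite !gamma_mobius.
move: (expgz A i) (expgz A j) (commute_expgz A i) (commute_expgz A j) => P P' cP cP'.
have cPV' : commute A^-1%g P' by apply/commute_sym/commuteV/commute_sym.
rewrite -(tr_SL2J (A * H * A^-1 * H^-1)%g P) !invgM !mulgA cP.
by rewrite -[(_ * P' * _)%g]mulgA -cPV' !mulgA mulgK.
Qed.

Lemma gamma_1 : gamma f 1%g = 0.
Proof. by apply: (@gamma_commute _ A 1%g); apply: commute1. Qed.

Lemma involution : beta g = -4 -> (g * g = 1)%g.
Proof.
rewrite beta_mobius => /eqP; rewrite subr_eq addNr sqrf_eq0 => /eqP t0.
rewrite -mobiusM; apply/mobius_eq1; right.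
by rewrite SL2_mulE SL2_CH t0 scale0r sub0r.
Qed.

(** Let x be a point of the group that is not isolated, and y in the group
    close to x.  Then [h = x^-1 y] is close to 1, so that both [gamma f h] and
    [gamma f (g h g)] are small.  The second one serves when h is a power of
    f: then [g h g] is still a reduced word. *)
Lemma not_discrete_small_word (e : R) : (g * g = 1)%g -> 0 < e ->
  ~ discrete_subset (generated [set f; g]) ->
  exists2 rs, reduced f rs & normc (gamma f (alternating f g rs)) < e.
Proof.
move=> gg e0 nd; pose L := generated [set f; g].
have [x Gx nx] : exists2 x, L x & ~ isolated L x.
  apply: contrapT => no; apply: nd => x Lx; apply: contrapT => nx.
  by apply: no; exists x.
have [P xP] := mobius_surj x.
pose V : set (PSL2 R[i]) := [set y | normc (gamma f (x^-1 * y)%g) < e] `&`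
  [set y | normc (gamma f (g * (x^-1 * y) * g)%g) < e].
have Vx : nbhs x V.
  apply: filterI.
    have := @gamma_nbhs R A P^-1%g 1%g x e.
    rewrite mobiusV -xP mulVg mulg1 gamma_1 normc0 => /(_ e0).
    by apply: filterS => y /=; rewrite mulg1.
  have := @gamma_nbhs R A (B * P^-1)%g B x e.
  rewrite mobiusM mobiusV -xP mulgVK -/g gg gamma_1 normc0 => /(_ e0).
  by apply: filterS => y /=; rewrite !mulgA.
have [y [Vy Gy yx]] : exists y, [/\ V y, generated [set f; g] y & y <> x].
  apply: contrapT => no; apply: nx; split; first exact/mem_set.
  exists V => //; apply/seteqP; split=> [y [Vy Gy]|y ->] /=.
    by apply: contrapT => yx; apply: no; exists y.
  by split => //; exact: nbhs_singleton.
have [_ GM GV] := subgroup_generated [set f; g].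
have Gh : generated [set f; g] (x^-1 * y)%g by apply: GM => //; apply: GV.
have h1 : (x^-1 * y)%g <> 1%g.
  by move=> h1; apply: yx; apply: (mulgI x^-1%g); rewrite h1 mulVg.
case: Vy => /=; move: (x^-1 * y)%g Gh h1 => h Gh h1 he ghe.
case: (generated_normal_form gg Gh) => [[i hi]|[i [j [rs [rs1 hi]]]]].
  exists [:: i].
    by move=> r; rewrite inE => /eqP ->; rewrite -hi; apply/eqP.
  by rewrite (@alternating_cons _ f g gg) -hi; exact: ghe.
exists rs; first exact: rs1.
rewrite hi gamma_expgz in he; exact: he.
Qed.

End Conclusion.

Theorem theorem12p1 (R : realType) (f g : PSL2 R[i]) :
  beta f <> -4 -> beta g = -4 ->
  ~ (discrete_subset (generated [set f; g]) /\
     is_free_product (generated [set f; g])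
       (generated [set f]) (generated [set g])) ->
  forall U : set R[i]^o, open U -> U (gamma f g) ->
  exists (w : good_word) (p : {poly {poly int}}),
    [/\ is_trace_poly R[i] w p,
        eval_fst p (beta f) != 0 &
        exists2 z : R[i], U z & root (eval_fst p (beta f)) z].
Proof.
have [A fA] := mobius_surj f; have [B gB] := mobius_surj g.
move=> /eqP f4 g4 nfree U Uo Ug.
suff [z Uz [rs rs0 rz]] : exists2 z, U z & word_root (beta f) z.
  exists (GoodWord false rs), (trace_poly rs); split => //.
    exact: is_trace_poly_trace_poly.
  by exists z.
have bE : beta f = \tr A ^+ 2 - 4 by rewrite fA beta_mobius.
have wp_neq0 rs : reduced f rs -> word_poly (beta f) rs != 0.
  by rewrite fA => rs1; rewrite beta_mobius; apply: word_poly_neq0.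
have [g0|g0] := eqVneq (gamma f g) 0.
  exists (gamma f g) => //; exists [::]; first exact: wp_neq0.
  by rewrite g0 /root word_poly0.
have f1 : f <> 1%g.
  move=> f1; move: g0; rewrite f1 gB -mobius1 gamma_commute ?eqxx //.
  exact/commute_sym/commute1.
have gg : (g * g = 1)%g by rewrite gB; apply: involution; rewrite -gB.
have wpE rs : (word_poly (beta f) rs).[gamma f g] = gamma f (alternating f g rs).
  exact: word_polyE.
have [[i [j [rs [rs1 rel]]]]|norel] := pselect (exists i j rs, reduced f rs /\
    (expgz f i * alternating f g rs * expgz f j)%g = 1%g).
  exists (gamma f g) => //; exists rs; first exact: wp_neq0.
  rewrite /root wpE; apply/eqP.
  by move: rel; rewrite fA -(gamma_expgz A i _ j) => ->; apply: gamma_1.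
have free : is_free_product (generated [set f; g]) (generated [set f]) (generated [set g]).
  apply: free_product_of_no_relation => // i j rs rs1 rel.
  by apply: norel; exists i, j, rs.
have ndisc : ~ discrete_subset (generated [set f; g]) by move=> d; apply: nfree.
have [d d0 dU] : exists2 d : R, 0 < d & forall y, normc (y - gamma f g) < d -> U y.
  have /nbhs_ballP[d /= d0 dU] := open_nbhs_nbhs (conj Uo Ug).
  have dE : d = ((complex.Re d)%:C)%C by case: d d0 {dU} => a b; rewrite ltcE /= => /andP[/eqP ->].
  exists (complex.Re d); first by move: d0; rewrite dE -[0]/((0%:C)%C) ltcR.
  move=> y yd; apply: dU; rewrite /ball /= distrC complex_normE dE ltcR //.
have bA : beta (mobius A) = beta f by rewrite fA.
have [e e0 He] := word_root_dense_near0 bA f4 (fun h => f1 (etrans fA h)).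
have [rs rs1 small] : exists2 rs, reduced f rs & normc (gamma f (alternating f g rs)) < e.
  move: ndisc gg; rewrite fA gB => ndisc gg.
  exact: not_discrete_small_word.
have [d' d'0 Hd] := poly_open (gamma f g) (word_poly_size (wp_neq0 _ rs1)) d0.
have [y yn Sy] := He _ small d' d'0.
have [z zd zy] : exists2 z, normc (z - gamma f g) < d & (word_poly (beta f) rs).[z] = y.
  by apply: Hd; rewrite wpE.
exists z; first exact: dU.
by apply: (word_root_pull (wp_neq0 _ rs1)); rewrite zy.
Qed.
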